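(* (i) For $(\rho,\phi)$ belonging to region 3, there is a unique limit cycle, which is asymptotically stable and of the form $[1,2]$, as well as an unstable equilibrium (namely $\boldsymbol\pi$, in the sense explained in the context). Indeed, $$\Delta_A=\Delta_{\overline{ABB}},$$ and for initial states in $\Delta_B-\Delta_{\overline B}$, the trajectory eventually enters $\Delta_A$, where $$\Delta_{\overline B}=\Big\{x\in\Delta_B:\Big(1+\tfrac{S}{1+\rho^2}\Big)(x_0-\pi_0)+2(x_1-\pi_1)=0\Big\}.$$ (ii) For $(\rho,\phi)$ belonging to region 9, 10, or 11, there is a unique limit cycle, which is globally asymptotically stable and of the form $[1,2]$. Indeed, $$\Delta_{ABBA}=\Delta_{\overline{ABB}},\qquad \Delta_A-\Delta_{ABBA}=\Delta_{AB\overline{ABB}},$$ and for initial states in $\Delta_B$, the trajectory eventually enters $\Delta_A$.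
   Context: Fix $\rho\in(0,1)$ and $\phi\in(0,1]$. Put $p_0:=\rho^2/(1+\rho^2)$, $p_1:=1/(1+\rho)$, $$\boldsymbol P_B^\circ:=\begin{pmatrix}0&p_0&1-p_0\\ 1-p_1&0&p_1\\ p_1&1-p_1&0\end{pmatrix},\qquad \boldsymbol P_A^\circ:=\begin{pmatrix}0&1/2&1/2\\ 1/2&0&1/2\\ 1/2&1/2&0\end{pmatrix},$$ $\boldsymbol P_A:=(1-\phi)\boldsymbol I+\phi\boldsymbol P_A^\circ$, $\boldsymbol P_B:=(1-\phi)\boldsymbol I+\phi\boldsymbol P_B^\circ$. The stationary distribution of $\boldsymbol P_B$ is $\boldsymbol\pi=(\pi_0,\pi_1,\pi_2)$ with $\pi_0=\frac{1+\rho^2}{2(1+\rho+\rho^2)}$, $\pi_1=\frac{\rho(1+\rho)}{2(1+\rho+\rho^2)}$, $\pi_2=\frac{1+\rho}{2(1+\rho+\rho^2)}$. Put $S:=\sqrt{(1+\rho^2)(1+4\rho+\rho^2)}$. Let $\Delta:=\{(x_0,x_1,x_2):x_i\ge0,\ x_0+x_1+x_2=1\}$ (row vectors), $\Delta_A:=\{x\in\Delta:x_0\ge\pi_0\}$, $\Delta_B:=\Delta-\Delta_A$. The discrete dynamical system (greedy strategy) is $x(n+1)=F(x(n))$, where $F(x):=x\boldsymbol P_A$ if $x\in\Delta_A$ (game $A$ is played) and $F(x):=x\boldsymbol P_B$ if $x\in\Delta_B$ (game $B$ is played). Game-sequence notation: for a finite word $W$ in $A,B$, $\Delta_W$ is the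 set of initial states in $\Delta$ for which the first games played are, in order, the letters of $W$ (e.g. $\Delta_{ABBA}$). An overlined word is repeated forever: $\Delta_{\overline{ABB}}$, $\Delta_{AB\overline{ABB}}$, $\Delta_{\overline B}$ are the sets of initial states whose complete game sequences are $ABBABBABB\cdots$, $AB\,ABBABB\cdots$, $BBB\cdots$, respectively. A limit cycle is a periodic orbit of $F$; it is of the form $[1,2]$ if the sequence of games played along it, started from a suitable point of the orbit, is $ABBABB\cdots$ (then the orbit is $\{\boldsymbol\pi_{[1,2]},\boldsymbol\pi_{[1,2]}\boldsymbol P_A,\boldsymbol\pi_{[1,2]}\boldsymbol P_A\boldsymbol P_B\}$, with $\boldsymbol\pi_{[1,2]}$ the stationary distribution of $\boldsymbol P_A\boldsymbol P_B^2$). ''Globally'' asymptotically stable means that trajectories from all initial states in $\Delta$ approach the cycle. The unstable equilibrium is the one corresponding to playing game $B$ forever: the point $\boldsymbol\pi$ (the fixed point of $x\mapsto x\boldsymbol P_B$), to which trajectories starting in the nonempty set $\Delta_{\overline B}$ converge, while arbitrarily close to $\boldsymbol\pi$ there are initial states whose trajectories do not converge to $\boldsymbol\pi$. Regions. For $n=1,2$ define $\alpha_n:=(-1)^{n-1}(1,0,-1)\boldsymbol P_A\boldsymbol P_B^n(1,0,0)^{T}$, $\beta_n:=(-1)^{n-1}(0,1,-1)\boldsymbol P_A\boldsymbol P_B^n(1,0,0)^{T}$, $\gamma_n:=(-1)^{n-1}[\boldsymbol\pi-(0,0,1)\boldsymbol P_A\boldsymbol P_B^n](1,0,0)^{T}$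 (for $\phi>2/3$ one has $\alpha_n,\beta_n>0$), and $a_n:=(\gamma_n-\alpha_n\pi_0)/\beta_n$, $b_n:=\gamma_n/\alpha_n$. Let $(f_0,f_1,f_2):=(1,0,0)\boldsymbol P_A\boldsymbol P_B$. The regions are subsets of the set of $(\rho,\phi)\in(0,1)\times(2/3,1]$ with $G_{4,2}>0$, where $$G_{4,2}:=\phi(1-\rho)\{e_2^2[4-e_1^6(3\phi-2)^2][2-e_2^2(3\phi-2)]K_--e_1^2[4-e_2^6(3\phi-2)^2][2-e_1^2(3\phi-2)]K_+\},$$ $K_\pm:=3(1+\rho)(1+\rho^2)\pm(1-\rho)S$, $e_1:=1-\frac32\phi+\frac{\phi(1-\rho)S}{2(1+\rho)(1+\rho^2)}$, $e_2:=1-\frac32\phi-\frac{\phi(1-\rho)S}{2(1+\rho)(1+\rho^2)}$: - region 3: $b_2\ge1$; - region 9: $b_2\ge b_1$ and $\phi<1-\rho/3$; - region 10: $\phi\ge1-\rho/3$ and $a_2\ge1-\pi_0$; - region 11: $b_2\ge b_1$, $a_2<1-\pi_0$, and $\alpha_1f_0+\beta_1f_1<\gamma_1$. *)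

(* Defs.v *)
From mathcomp Require Import all_boot all_order all_algebra.
From mathcomp Require Import all_classical all_reals all_analysis.
Import Order.TTheory GRing.Theory Num.Theory.
Import numFieldNormedType.Exports.

Set Implicit Arguments.
Unset Strict Implicit.
Unset Printing Implicit Defensive.

Local Open Scope classical_set_scope.
Local Open Scope ring_scope.

Definition row3 (R : realType) (a b c : R) : 'rV[R]_3 :=
  \row_j nth 0 [:: a; b; c] j.

Definition mx3 (R : realType) (rows : seq (seq R)) : 'M[R]_3 :=
  \matrix_(i, j) nth 0 (nth [::] rows i) j.

Section Games.
Variables (R : realType) (rho phi : R).

Definition p0 : R := rho ^+ 2 / (1 + rho ^+ 2).
Definition p1 : R := 1 / (1 + rho).

Definition PBcirc : 'M[R]_3 :=
  mx3 [:: [:: 0;      p0;     1 - p0];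
          [:: 1 - p1; 0;      p1];
          [:: p1;     1 - p1; 0]].

Definition PAcirc : 'M[R]_3 :=
  mx3 [:: [:: 0;     1 / 2; 1 / 2];
          [:: 1 / 2; 0;     1 / 2];
          [:: 1 / 2; 1 / 2; 0]].

Definition PA : 'M[R]_3 := (1 - phi) *: 1%:M + phi *: PAcirc.
Definition PB : 'M[R]_3 := (1 - phi) *: 1%:M + phi *: PBcirc.

Definition pi0 : R := (1 + rho ^+ 2) / (2 * (1 + rho + rho ^+ 2)).
Definition pi1 : R := rho * (1 + rho) / (2 * (1 + rho + rho ^+ 2)).
Definition pi2 : R := (1 + rho) / (2 * (1 + rho + rho ^+ 2)).
Definition piB : 'rV[R]_3 := row3 pi0 pi1 pi2.

Definition Sroot : R :=
  Num.sqrt ((1 + rho ^+ 2) * (1 + 4 * rho + rho ^+ 2)).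

Definition simplex : set 'rV[R]_3 :=
  [set x | (forall i, 0 <= x 0 i) /\ \sum_i x 0 i = 1].

Definition DeltaA : set 'rV[R]_3 := [set x | simplex x /\ pi0 <= x 0 0].
Definition DeltaB : set 'rV[R]_3 := simplex `\` DeltaA.

Inductive game := gA | gB.

Definition game_at (x : 'rV[R]_3) : game := if pi0 <= x 0 0 then gA else gB.

(* The greedy map, extended to all row vectors by the same formula; it is only
   ever iterated from points of the simplex, which it preserves. *)
Definition F (x : 'rV[R]_3) : 'rV[R]_3 :=
  x *m (if game_at x is gA then PA else PB).

Definition traj (x : 'rV[R]_3) (n : nat) : 'rV[R]_3 := iter n F x.

Definition Delta_word (w : seq game) : set 'rV[R]_3 :=
  [set x | simplex x /\
     forall n, (n < size w)%N -> game_at (traj x n) = nth gA w n].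

(* [Delta_rep u v] is for the infinite game sequence u v v v ..., where v is
   meant to be nonempty. *)
Definition Delta_rep (u v : seq game) : set 'rV[R]_3 :=
  [set x | simplex x /\
     forall n, game_at (traj x n) =
       if (n < size u)%N then nth gA u n
       else nth gA v ((n - size u) %% size v)%N].

Definition limit_cycle (G : set 'rV[R]_3) : Prop :=
  exists x p, [/\ simplex x, (0 < p)%N, traj x p = x & G = range (traj x)].

Definition form12 (G : set 'rV[R]_3) : Prop :=
  exists2 x, G x & Delta_rep [::] [:: gA; gB; gB] x.

Definition near_set (G : set 'rV[R]_3) (e : R) : set 'rV[R]_3 :=
  [set x | exists2 y, G y & `|x - y| < e].

Definition approaches (x : 'rV[R]_3) (G : set 'rV[R]_3) : Prop :=
  forall e, 0 < e -> \forall n \near \oo, near_set G e (traj x n).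

Definition lyapunov_stable (G : set 'rV[R]_3) : Prop :=
  forall e, 0 < e -> exists2 d, 0 < d &
    forall x, simplex x -> near_set G d x -> forall n, near_set G e (traj x n).

Definition asymptotically_stable (G : set 'rV[R]_3) : Prop :=
  lyapunov_stable G /\
  exists2 d, 0 < d & forall x, simplex x -> near_set G d x -> approaches x G.

Definition globally_asymptotically_stable (G : set 'rV[R]_3) : Prop :=
  lyapunov_stable G /\ forall x, simplex x -> approaches x G.

(* [q] is an equilibrium of the game-B map only: it need not be fixed by [F],
   and [piB] is not, since it lies in [DeltaA].  In the last clause [x != q]
   keeps [q] itself from being the witness. *)
Definition unstable_equilibrium (q : 'rV[R]_3) : Prop :=
  [/\ simplex q,
      q *m PB = q,
      Delta_rep [::] [:: gB] !=set0,
      (forall x, Delta_rep [::] [:: gB] x -> traj x n @[n --> \oo] --> q)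
    & forall e, 0 < e -> exists x,
        [/\ simplex x, x != q, `|x - q| < e
          & ~ (traj x n @[n --> \oo] --> q)]].

Definition alpha (n : nat) : R :=
  (-1) ^+ n.-1 * (row3 1 0 (-1) *m PA *m PB ^+ n *m (row3 1 0 0)^T) 0 0.
Definition beta (n : nat) : R :=
  (-1) ^+ n.-1 * (row3 0 1 (-1) *m PA *m PB ^+ n *m (row3 1 0 0)^T) 0 0.
Definition gamma (n : nat) : R :=
  (-1) ^+ n.-1 *
    ((piB - row3 0 0 1 *m PA *m PB ^+ n) *m (row3 1 0 0)^T) 0 0.

Definition a_ (n : nat) : R := (gamma n - alpha n * pi0) / beta n.
Definition b_ (n : nat) : R := gamma n / alpha n.

Definition fvec : 'rV[R]_3 := row3 1 0 0 *m PA *m PB.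

Definition Kplus : R :=
  3 * (1 + rho) * (1 + rho ^+ 2) + (1 - rho) * Sroot.
Definition Kminus : R :=
  3 * (1 + rho) * (1 + rho ^+ 2) - (1 - rho) * Sroot.
Definition e1 : R :=
  1 - 3 / 2 * phi
  + phi * (1 - rho) * Sroot / (2 * (1 + rho) * (1 + rho ^+ 2)).
Definition e2 : R :=
  1 - 3 / 2 * phi
  - phi * (1 - rho) * Sroot / (2 * (1 + rho) * (1 + rho ^+ 2)).

Definition G42 : R :=
  phi * (1 - rho) *
  (e2 ^+ 2 * (4 - e1 ^+ 6 * (3 * phi - 2) ^+ 2)
     * (2 - e2 ^+ 2 * (3 * phi - 2)) * Kminus
   - e1 ^+ 2 * (4 - e2 ^+ 6 * (3 * phi - 2) ^+ 2)
     * (2 - e1 ^+ 2 * (3 * phi - 2)) * Kplus).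

Definition base_region : Prop :=
  [/\ 0 < rho < 1, 2 / 3 < phi <= 1 & 0 < G42].

Definition region3 : Prop := base_region /\ 1 <= b_ 2.
Definition region9 : Prop :=
  [/\ base_region, b_ 1 <= b_ 2 & phi < 1 - rho / 3].
Definition region10 : Prop :=
  [/\ base_region, 1 - rho / 3 <= phi & 1 - pi0 <= a_ 2].
Definition region11 : Prop :=
  [/\ base_region, b_ 1 <= b_ 2, a_ 2 < 1 - pi0
    & alpha 1 * fvec 0 0 + beta 1 * fvec 0 1 < gamma 1].

End Games.

(* Main.v *)
Require Import Defs.
From mathcomp Require Import all_boot all_order all_algebra.
From mathcomp Require Import all_classical all_reals all_analysis.
From mathcomp Require Import ring lra.
Import Order.TTheory GRing.Theory Num.Theory.
Import numFieldNormedType.Exports.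

Set Implicit Arguments.
Unset Strict Implicit.
Unset Printing Implicit Defensive.

Local Open Scope classical_set_scope.
Local Open Scope ring_scope.

(** Let [h x = x_0 - pi_0], so that game A is played exactly when [h x >= 0].
On vectors of mass one, [h (x A) = - kap * h x - drift] with [kap, drift > 0],
so B always follows A, and by Cayley-Hamilton
[h (x B B) = - 2 * kap * h (x B) - detB * h x], where [detB = e1 * e2].
If [detB < 0] then, after an A, [h (x A B B) >= 0] forces [h (x A B) < 0]; if
[detB >= 0] the converse implication holds.  The affine function
[x |-> h (x A B B)] is least on the simplex at the vertex (1,0,0), with value
[apex].  Region 3 says [apex >= 0], which is incompatible with [detB >= 0];
hence ABB maps [DeltaA] to itself.  Regions 9, 10, 11 give [detB >= 0] and
[drift + kap * apex > 0]; the latter says that [h < 0] after ABAB started at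
(1,0,0), hence anywhere, and it also implies that ABB preserves the set of
points of [DeltaA] that play ABB.  Playing B is nonexpansive and playing A
at least halves the l1 distance of two states, so all trajectories playing ABB
forever merge with that of the fixed point of ABB, and [G42 > 0] puts this fixed
point strictly inside [DeltaA], so that nearby states play the same games. *)

(** * Inequalities in two parameters *)

(* Here [k = kap], [m = (1 - rho) / 2] and [d = detB]; the conclusion
   is [0 < drift + kap * apex] with denominators cleared, see [apex_drift]. *)
Lemma shallow_ineq (R : realFieldType) (k m d : R) : 0 < k -> k <= 1 / 2 -> 0 < m ->
  m < 1 / 2 -> 0 <= d -> d <= k ^+ 2 ->
  2 * k * (k - m) <= d * m ->
  k ^+ 2 * (2 * k ^+ 2 - d) * (3 - 6 * m + 4 * m ^+ 2) < m ^+ 2 * (1 + k + 2 * k ^+ 2 + k * d).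
Proof.
move=> k0 k1 m0 m1 d0 d1 h.
(* Since [d <= k ^+ 2], the hypothesis keeps [m] above [3 / 4 * k]. The left side falls and the
   right side grows in [m] and in [d], so putting [m = 3 / 4 * k] and [d = 0] leaves an inequality
   in [k] alone. *)
have km : 3 * k <= 4 * m.
  have : d * m <= k ^+ 2 * m by rewrite ler_wpM2r // ltW.
  have : k * (2 * (k - m)) <= k * (k * m) by nra.
  rewrite ler_pM2l //; nra.
have q0 : 0 < 3 - 6 * m + 4 * m ^+ 2 by nra.
have q1 : 3 - 6 * m + 4 * m ^+ 2 <= 3 - 9 / 2 * k + 9 / 4 * k ^+ 2 by nra.
have s1 : k ^+ 2 * (2 * k ^+ 2 - d) * (3 - 6 * m + 4 * m ^+ 2) <=
  k ^+ 2 * (2 * k ^+ 2) * (3 - 9 / 2 * k + 9 / 4 * k ^+ 2).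
  apply: ler_pM => //; [|exact: ltW|]; first by apply: mulr_ge0; nra.
  by apply: ler_wpM2l; nra.
have s2 : m ^+ 2 * (1 + k + 2 * k ^+ 2) <= m ^+ 2 * (1 + k + 2 * k ^+ 2 + k * d)
  by apply: ler_wpM2l; nra.
have s3 : (9 / 16) * k ^+ 2 * (1 + k + 2 * k ^+ 2) <= m ^+ 2 * (1 + k + 2 * k ^+ 2)
  by apply: ler_wpM2r; nra.
have s4 : k ^+ 2 * (2 * k ^+ 2 * (3 - 9 / 2 * k + 9 / 4 * k ^+ 2)) <
  k ^+ 2 * ((9 / 16) * (1 + k + 2 * k ^+ 2)).
  rewrite ltr_pM2l ?exprn_gt0 //; nra.
lra.
Qed.

(* Same parameters, with [t = detB / kap ^+ 2]; the conclusion says that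
   [h < 0] after ABBAB started at the vertex (pi0, 0, 1 - pi0).  The threshold
   [k ^+ 2 * (1 - t / 10)] for [m] lies between the one given by the hypothesis
   and the one required by the conclusion, which are close at [k = 1 / 2]. *)
Lemma reentry_ineq (R : realFieldType) (k m t : R) : 0 < k -> k <= 1 / 2 -> 0 < m ->
  m < 1 / 2 -> 0 <= t -> t <= 1 ->
  k ^+ 4 * (2 - t) * (3 - 6 * m + 4 * m ^+ 2) < m ^+ 2 * (1 + k + 2 * k ^+ 2 + k ^+ 3 * t) ->
  k ^+ 3 * (4 - t) * (k + m * (1 - 2 * k)) + 2 * k ^+ 4 * t * m < m.
Proof.
move=> k0 k1 m0 m1 t0 t1 h.
have k20 : 0 < k ^+ 2 by rewrite exprn_gt0.
have k21 : k ^+ 2 <= 1 / 4 by nra.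
have k3 : 0 <= k ^+ 3 <= 1 / 4 * k by rewrite exprS; apply/andP; split; nra.
have kt : k ^+ 2 * (1 - t / 10) < m.
  rewrite ltNge; apply/negP => hm.
  have mk : m <= k ^+ 2 by nra.
  (* [2 + t / 8] is the value of the last factor at [k = 1 / 2]. Likewise [7 / 4] below is the value
     of the quadratic in [m] at [1 / 4], which bounds [k ^+ 2] and hence [m]. *)
  have s1 : m ^+ 2 * (1 + k + 2 * k ^+ 2 + k ^+ 3 * t) <=
    (k ^+ 2 * (1 - t / 10)) ^+ 2 * (2 + t / 8).
    apply: ler_pM; [nra|nra| |nra].
    by rewrite lerXn2r // ?nnegrE; nra.
  have s2 : (1 - t / 10) ^+ 2 * (2 + t / 8) <= (2 - t) * (3 - 6 * m + 4 * m ^+ 2).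
    have f0 : 7/4 <= 3 - 6 * m + 4 * m ^+ 2 by nra.
    have f1 : (2 - t) * (7/4) <= (2 - t) * (3 - 6 * m + 4 * m ^+ 2) by apply: ler_wpM2l; lra.
    have f2 : 0 <= t ^+ 2 <= t by apply/andP; split; nra.
    have f3 : t ^+ 3 <= t by rewrite exprS; nra.
    lra.
  have : k ^+ 4 * ((1 - t / 10) ^+ 2 * (2 + t / 8)) <=
    k ^+ 4 * ((2 - t) * (3 - 6 * m + 4 * m ^+ 2)).
    by rewrite ler_pM2l // exprn_gt0.
  lra.
(* The conclusion is linear in [m]; this is its nonstrict form at the threshold, divided by
   [k ^+ 2]. The two sides differ by the sum of the nonnegative terms in [d2], [d3] and [d4], an
   interpolation between [t = 0] and [t = 1] with a correction. *)
have c0 : k ^+ 2 * (4 - t) <= (1 - t / 10) * (1 - k ^+ 3 * (4 - t) * (1 - 2 * k) - 2 *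
  k ^+ 4 * t).
  have d0 : 0 <= (1 - 2 * k) * (1 + 2 * k - 4 * k ^+ 3) by apply: mulr_ge0; lra.
  have d1 : 0 <= 9/10 - 3 * k ^+ 2 - 27/10 * k ^+ 3 + 32/10 * k ^+ 4 by rewrite !exprS expr0;
    nra.
  have d2 : 0 <= k ^+ 3 * t * (1 / 10 * (1 - t) + 4 / 10 * k * t).
    by apply: mulr_ge0; [apply: mulr_ge0|apply: addr_ge0; apply: mulr_ge0; nra]; lra.
  have d3 : 0 <= (1 - t) * ((1 - 2 * k) * (1 + 2 * k - 4 * k ^+ 3)) by apply: mulr_ge0; lra.
  have d4 : 0 <= t * (9/10 - 3 * k ^+ 2 - 27/10 * k ^+ 3 + 32/10 * k ^+ 4) by apply: mulr_ge0.
  lra.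
have c1 : 0 < 1 - k ^+ 3 * (4 - t) * (1 - 2 * k) - 2 * k ^+ 4 * t.
  rewrite -(pmulr_rgt0 _ (_ : 0 < 1 - t / 10)); last lra.
  by apply: lt_le_trans c0; apply: mulr_gt0; lra.
have : k ^+ 2 * (k ^+ 2 * (4 - t)) <= k ^+ 2 * ((1 - t / 10) * (1 - k ^+ 3 * (4 - t) *
  (1 - 2 * k) - 2 * k ^+ 4 * t)).
  by rewrite ler_pM2l.
have : k ^+ 2 * (1 - t / 10) * (1 - k ^+ 3 * (4 - t) * (1 - 2 * k) - 2 * k ^+ 4 * t) <
  m * (1 - k ^+ 3 * (4 - t) * (1 - 2 * k) - 2 * k ^+ 4 * t).
  by rewrite ltr_pM2r.
lra.
Qed.

(* With [s = (1 - phi) / phi] and [v = rho / (1 + rho) ^+ 2], the hypothesis is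
   [0 <= detB] and the conclusion is [apex < 0], up to positive factors.  Both
   degenerate at the corner [s = 1 / 2, v = 1 / 4], i.e. [phi = 2 / 3, rho = 1]. *)
Lemma apex_poly_gt0 (R : realFieldType) (s v : R) : 0 <= s -> s < 1/2 -> 0 < v -> v < 1/4 ->
  0 <= 2 * v ^+ 2 - (1 - 2 * v) * s * (1 - s) ->
  0 < 4 * v ^+ 3 - 2 * (1 - 2 * s) * (2 + 3 * s) * v ^+ 2 + (1 + 2 * s - 12 * s ^+ 2 +
    2 * s ^+ 3) * v - s * (1 - 3 * s + s ^+ 2).
Proof.
move=> s0 s1 v0 v1 h.
(* As [4 * v < 1], one has [2 * v ^+ 2 < (1 - 2 * v) * v], and [h] compares the left side with
   [s * (1 - s)]. *)
have hv : s * (1 - s) < v.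
  rewrite -(ltr_pM2l (_ : 0 < 1 - 2 * v)); last lra.
  have : 0 < v * (1 - 4 * v) by apply: mulr_gt0; lra.
  lra.
have -> : 4 * v ^+ 3 - 2 * (1 - 2 * s) * (2 + 3 * s) * v ^+ 2 + (1 + 2 * s - 12 * s ^+ 2 +
  2 * s ^+ 3) * v - s * (1 - 3 * s + s ^+ 2)
  = (1 - 2 * s) / 2 * (2 * v ^+ 2 - (1 - 2 * v) * s * (1 - s)) +
    (1 - 4 * v) * ((v - s * (1 - s)) * (1 - v) + (1 - 4 * v) * s * (1 + s) / 2) by field.
apply: ltr_wpDl; first by apply: mulr_ge0; lra.
apply: mulr_gt0; first lra.
apply: ltr_pwDl; first by apply: mulr_gt0; lra.
by apply: mulr_ge0; [apply: mulr_ge0; [apply: mulr_ge0|]|]; lra.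
Qed.

(** The function [x ^+ 4 * (1 - x ^+ 2)] increases while [x ^+ 2 <= 2 / 3], which covers
    [b <= 4 / 5]. For larger [b] the constraint forces [a <= 1 / 5], and crude bounds suffice. *)
Lemma sextic_le (R : realFieldType) (a b : R) : 0 <= a -> a <= b -> a + b <= 1 ->
  a ^+ 4 * (1 - a ^+ 2) <= b ^+ 4 * (1 - b ^+ 2).
Proof.
move=> a0 ab hab.
have [hb|hb] := lerP b (4/5).
  have A : a ^+ 2 <= b ^+ 2 by nra.
  have B : b ^+ 2 <= 16/25 by nra.
  have a20 : 0 <= a ^+ 2 by nra.
  have : 0 <= (b ^+ 2 - a ^+ 2) * (b ^+ 2 * (1 - b ^+ 2) + a ^+ 2 * (1 - b ^+ 2 - a ^+ 2)).
    apply: mulr_ge0; first lra.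
    set x := a ^+ 2 in A a20 *; set y := b ^+ 2 in A B *; nra.
  lra.
have ha : a <= 1/5 by lra.
have a4 : a ^+ 4 <= a * (1/125).
  rewrite exprS ler_wpM2l //.
  have : a ^+ 3 <= (1/5) ^+ 3 by rewrite lerXn2r // ?nnegrE; lra.
  lra.
have b4 : (4/5) ^+ 4 <= b ^+ 4 by rewrite lerXn2r // ?nnegrE; lra.
have a40 : 0 <= a ^+ 4 by apply: exprn_ge0.
have : a ^+ 4 * (1 - a ^+ 2) <= a ^+ 4 by nra.
have : a * (2/5) <= b ^+ 4 * (1 - b ^+ 2).
  have e : a <= 1 - b ^+ 2 by nra.
  set y := b ^+ 4 in b4 *; set x := 1 - b ^+ 2 in e *; nra.
lra.
Qed.

Lemma sum_ord3 (V : nmodType) (f : 'I_3 -> V) : \sum_i f i = f 0 + f 1 + f 2.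
Proof.
rewrite !big_ord_recl big_ord0 addr0 addrA.
by congr (f _ + f _ + f _); apply/val_inj.
Qed.

Lemma ord3P (P : 'I_3 -> Prop) : P 0 -> P 1 -> P 2 -> forall i, P i.
Proof.
move=> p0 p1 p2 [[|[|[|//]]] hi].
- by rewrite (_ : Ordinal hi = 0) //; apply/val_inj.
- by rewrite (_ : Ordinal hi = 1) //; apply/val_inj.
- by rewrite (_ : Ordinal hi = 2) //; apply/val_inj.
Qed.

(** * The two games in coordinates *)

Section Coord.
Variables (R : realType) (rho phi : R).
Implicit Type x : 'rV[R]_3.
Local Notation A := (PA phi).
Local Notation B := (PB rho phi).

Lemma mulPA x i : (x *m A) 0 i = (1 - 3 / 2 * phi) * x 0 i + phi / 2 * \sum_j x 0 j.
Proof.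
move: i; apply: ord3P; rewrite !mxE !sum_ord3 !mxE /=; by field.
Qed.

Lemma mulPB0 x : (x *m B) 0 0 = (1 - phi) * x 0 0 + phi * ((1 - p1 rho) * x 0 1 +
  p1 rho * x 0 2).
Proof. by rewrite !mxE !sum_ord3 !mxE /=; ring. Qed.
Lemma mulPB1 x : (x *m B) 0 1 = (1 - phi) * x 0 1 + phi * (p0 rho * x 0 0 +
  (1 - p1 rho) * x 0 2).
Proof. by rewrite !mxE !sum_ord3 !mxE /=; ring. Qed.
Lemma mulPB2 x : (x *m B) 0 2 = (1 - phi) * x 0 2 + phi * ((1 - p0 rho) * x 0 0 +
  p1 rho * x 0 1).
Proof. by rewrite !mxE !sum_ord3 !mxE /=; ring. Qed.

Lemma mass_mulPA x : \sum_i (x *m A) 0 i = \sum_i x 0 i.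
Proof. by under eq_bigr do rewrite mulPA; rewrite !sum_ord3; field. Qed.

Lemma mass_mulPB x : \sum_i (x *m B) 0 i = \sum_i x 0 i.
Proof. by rewrite !sum_ord3 mulPB0 mulPB1 mulPB2; ring. Qed.

Definition excess x : R := x 0 0 - pi0 rho.
(* On zero-sum vectors A is the scalar [- kap], while B has trace [- 2 * kap]
   and determinant [detB]. *)
Definition kap : R := (3 * phi - 2) / 2.
Definition drift : R := phi * (1 - rho) ^+ 2 / (4 * (1 + rho + rho ^+ 2)).
Definition detB : R :=
  (1 - phi) * (1 - 2 * phi)
  + 2 * phi ^+ 2 * rho ^+ 2 / ((1 + rho) ^+ 2 * (1 + rho ^+ 2)).

Hypothesis prm : [/\ 0 < rho, rho < 1, 2 / 3 < phi & phi <= 1].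

Lemma den1_gt0 : 0 < 1 + rho. Proof. case: prm => r0 r1 f0 f1. nra. Qed.
Lemma den1 : 1 + rho != 0. Proof. by rewrite gt_eqF ?den1_gt0. Qed.
Lemma den2_gt0 : 0 < 1 + rho ^+ 2. Proof. case: prm => r0 r1 f0 f1. nra. Qed.
Lemma den2 : 1 + rho ^+ 2 != 0. Proof. by rewrite gt_eqF ?den2_gt0. Qed.
Lemma den3_gt0 : 0 < 1 + rho + rho ^+ 2. Proof. case: prm => r0 r1 f0 f1. nra. Qed.
Lemma den3 : 1 + rho + rho ^+ 2 != 0. Proof. by rewrite gt_eqF ?den3_gt0. Qed.

Lemma mass1E x : \sum_i x 0 i = 1 -> x 0 2 = 1 - x 0 0 - x 0 1.
Proof. by rewrite sum_ord3 => <-; ring. Qed.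

Lemma excess_A x : \sum_i x 0 i = 1 -> excess (x *m A) = - kap * excess x - drift.
Proof.
move=> x1; rewrite /excess mulPA x1 /kap /drift /pi0.
by field; rewrite den3.
Qed.

Lemma excess_B x : \sum_i x 0 i = 1 ->
  excess (x *m B) = (1 - phi - phi / (1 + rho)) * excess x -
    phi * (1 - rho) / (1 + rho) * (x 0 1 - pi1 rho).
Proof.
move=> x1; rewrite /excess mulPB0 (mass1E x1) /p1 /pi0 /pi1.
by field; rewrite den3 den1.
Qed.

Lemma excess_BB x : \sum_i x 0 i = 1 ->
  excess (x *m B *m B) = - 2 * kap * excess (x *m B) - detB * excess x.
Proof.
move=> x1; rewrite /excess !mulPB0 mulPB1 mulPB2 (mass1E x1) /p1 /p0 /pi0 /kap /detB.
by field; rewrite den3 den2 den1.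
Qed.

(** The right side is also [h] after BA: [A] mixes the identity with the map to the uniform vector,
    and [B] keeps coordinate 0 of the uniform vector because its first column sums to one. *)
Lemma excess_AB x : \sum_i x 0 i = 1 -> excess (x *m A *m B) = - kap * excess (x *m B) - drift.
Proof.
move=> x1; rewrite /excess !mulPB0 !mulPA x1 (mass1E x1) /p1 /pi0 /kap /drift.
by field; rewrite den3 den1.
Qed.

Lemma kap_gt0 : 0 < kap. Proof. case: prm => r0 r1 f0 f1. by rewrite /kap; lra. Qed.
Lemma kap_le : kap <= 1 / 2. Proof. case: prm => r0 r1 f0 f1. by rewrite /kap; lra. Qed.
Lemma drift_gt0 : 0 < drift.
Proof. case: prm => r0 r1 f0 f1. by rewrite /drift divr_gt0 // ?mulr_gt0 ?exprn_gt0 //;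
  nra. Qed.

(** The eigenvalues of [B] on zero-sum vectors are real: their discriminant is nonnegative by two
    instances of the arithmetic-geometric mean inequality. *)
Lemma detB_le : detB <= kap ^+ 2.
Proof. case: prm => r0 r1 f0 f1.
have -> : detB = kap ^+ 2 - phi ^+ 2 * (1 / 4 - 2 * rho ^+ 2 / ((1 + rho) ^+ 2 * (1 +
  rho ^+ 2))).
  by rewrite /detB /kap; field; rewrite den2 den1.
rewrite gerBl mulr_ge0 ?sqr_ge0 // subr_ge0 ler_pdivrMr; last first.
  by rewrite mulr_gt0 ?exprn_gt0; nra.
have e1 : 4 * rho <= (1 + rho) ^+ 2 by nra.
have e2 : 2 * rho <= 1 + rho ^+ 2 by nra.
have : 4 * rho * (2 * rho) <= (1 + rho) ^+ 2 * (1 + rho ^+ 2) by apply: ler_pM => //; lra.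
lra.
Qed.

Lemma pi0_gt0 : 0 < pi0 rho. Proof. case: prm => r0 r1 f0 f1. by rewrite /pi0 divr_gt0 //;
  nra. Qed.
Lemma pi1_gt0 : 0 < pi1 rho. Proof. case: prm => r0 r1 f0 f1. by rewrite /pi1 divr_gt0 //;
  nra. Qed.
Lemma pi2_gt0 : 0 < pi2 rho. Proof. case: prm => r0 r1 f0 f1. by rewrite /pi2 divr_gt0 //;
  nra. Qed.
Lemma pi_sum : pi0 rho + pi1 rho + pi2 rho = 1.
Proof. by rewrite /pi0 /pi1 /pi2; field; rewrite den3. Qed.

Lemma excess_ABB x : \sum_i x 0 i = 1 ->
  excess (x *m A *m B *m B) = 2 * kap * (kap * excess (x *m B) + drift) +
    detB * (kap * excess x + drift).
Proof.
move=> x1; rewrite excess_BB ?mass_mulPA // excess_AB // excess_A //; ring.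
Qed.

End Coord.

(** * The composite games ABB, ABAB and ABBAB on the simplex *)

Section Model.
Variables (R : realType) (rho phi : R).
Implicit Type x : 'rV[R]_3.
Local Notation A := (PA phi).
Local Notation B := (PB rho phi).
Local Notation k := (kap phi).
Local Notation C := (drift rho phi).
Local Notation d := (detB rho phi).
Local Notation h := (excess rho).

Hypothesis prm : [/\ 0 < rho, rho < 1, 2 / 3 < phi & phi <= 1].

(* The value of [h] after ABB started at the vertex (1,0,0). *)
Definition apex : R := 2 * k * (k * (1 - pi0 rho - phi) + C) + d * (k * (1 - pi0 rho) + C).

Lemma excess_ABB_apex x : \sum_i x 0 i = 1 ->
  h (x *m A *m B *m B) = apex
   + k * (2 * k * (phi + phi / (1 + rho) - 1) - d) * (1 - x 0 0)
   - 2 * k ^+ 2 * (phi * (1 - rho) / (1 + rho)) * x 0 1.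
Proof.
move=> x1; rewrite (excess_ABB prm x1) (excess_B prm x1) /apex /excess.
rewrite /pi1 /pi0.
by field; rewrite (den1 prm) (den3 prm).
Qed.

(** The right side is minus the coefficient of [h x] in [excess_B]. *)
Lemma rise_ge : k <= phi + phi / (1 + rho) - 1.
Proof.
case: prm => r0 r1 f0 f1.
have : phi / 2 <= phi / (1 + rho) by rewrite ler_pM2l ?lef_pV2 ?posrE; lra.
by rewrite /kap; lra.
Qed.

(** [k] times the difference of the two sides is the increase of [h] after ABB from the vertex
    (1,0,0) to (0,1,0). It is nonnegative as a sum of two visibly nonnegative terms. *)
Lemma slope_ge : d <= 2 * k * (phi + phi / (1 + rho) - 1 - phi * (1 - rho) / (1 + rho)).
Proof.
case: prm => r0 r1 f0 f1.
rewrite -subr_ge0.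
have -> : 2 * k * (phi + phi / (1 + rho) - 1 - phi * (1 - rho) / (1 + rho)) - d
  = (1 - phi * (1 + rho / (1 + rho))) ^+ 2 + phi ^+ 2 * rho * (1 - rho) ^+ 2 / ((1 +
    rho) ^+ 2 * (1 + rho ^+ 2)).
  by rewrite /detB /kap; field; rewrite (den1 prm) (den2 prm).
apply: addr_ge0; first exact: sqr_ge0.
apply: divr_ge0; first by apply: mulr_ge0; [apply: mulr_ge0;
  [exact: sqr_ge0|lra]|exact: sqr_ge0].
by apply: mulr_ge0; [exact: sqr_ge0|exact/ltW/(den2_gt0 prm)].
Qed.

Lemma simplexP x : simplex x -> [/\ 0 <= x 0 0, 0 <= x 0 1, 0 <= x 0 2 & \sum_i x 0 i = 1].
Proof. by case. Qed.

Lemma apex_le x : simplex x -> apex <= h (x *m A *m B *m B).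
Proof.
move=> sx; have [x0 x1 x2 xs] := simplexP sx.
rewrite (excess_ABB_apex xs).
have : 0 <= k * ((2 * k * (phi + phi / (1 + rho) - 1 - phi * (1 - rho) / (1 +
  rho)) - d) * (1 - x 0 0)).
  apply: mulr_ge0; first exact/ltW/(kap_gt0 prm).
  have := mass1E xs; have := slope_ge; move=> s e.
  by apply: mulr_ge0; lra.
have : 0 <= (2 * k ^+ 2 * (phi * (1 - rho) / (1 + rho))) * (1 - x 0 0 - x 0 1).
  case: prm => r0 r1 f0 f1.
  apply: mulr_ge0; last by rewrite -(mass1E xs).
  apply: mulr_ge0; first by rewrite mulr_ge0 ?sqr_ge0.
  by apply: divr_ge0; nra.
lra.
Qed.

(** A common factor: [drift] is [U * (1 - rho) / 2], and the constant term of [excess_B] is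
    [U * rho]. *)
Let U := phi * (1 - rho) / (2 * (1 + rho + rho ^+ 2)).

Lemma driftU : C = U * ((1 - rho) / 2).
Proof. by rewrite /U /drift; field; rewrite (den3 prm). Qed.

Lemma U_gt0 : 0 < U.
Proof. by case: (prm) => r0 r1 f0 f1; rewrite /U; apply: divr_gt0; [|have := den3_gt0 prm];
  nra. Qed.

Lemma excess_ABBAB x : \sum_i x 0 i = 1 ->
  h (x *m A *m B *m B *m A *m B) = 2 * k ^+ 2 * h (x *m A *m B *m B) +
    k * d * h (x *m A *m B) - C.
Proof.
move=> xs; have ys : \sum_i (x *m A *m B) 0 i = 1 by rewrite mass_mulPB mass_mulPA.
have zs : \sum_i (x *m A *m B *m B) 0 i = 1 by rewrite mass_mulPB.
by rewrite (excess_AB prm zs) (excess_BB prm ys); ring.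
Qed.

Lemma excess_ABAB x : \sum_i x 0 i = 1 ->
  h (x *m A *m B *m A *m B) = - k * h (x *m A *m B *m B) - C.
Proof.
move=> xs; have ys : \sum_i (x *m A *m B) 0 i = 1 by rewrite mass_mulPB mass_mulPA.
exact: (excess_AB prm ys).
Qed.

(** With [m = (1 - rho) / 2] one has [1 + rho + rho ^+ 2 = 3 - 6 * m + 4 * m ^+ 2]. Positivity of
    the right side is the conclusion of [shallow_ineq] and the hypothesis of [reentry_ineq]. *)
Lemma apex_drift : (C + k * apex) * (1 + rho + rho ^+ 2) =
  2 / 3 * (((1 - rho) / 2) ^+ 2 * (1 + k + 2 * k ^+ 2 + k * d)
   - k ^+ 2 * (2 * k ^+ 2 - d) * (3 - 6 * ((1 - rho) / 2) + 4 * ((1 - rho) / 2) ^+ 2)).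
Proof.
rewrite /apex; move: d => e; rewrite /drift /kap /pi0.
by field; rewrite (den3 prm).
Qed.

(** The value increases with [h (x *m B)], which is at most [- k * h x + U * rho]; after this
    substitution it decreases in [h x], both because [d <= k ^+ 2]. The worst case is thus the
    vertex (pi0, 0, 1 - pi0), settled by [reentry_ineq]. *)
Lemma ABBAB_lt0 x : simplex x -> pi0 rho <= x 0 0 -> 0 <= d -> 0 < C + k * apex ->
  h (x *m A *m B *m B *m A *m B) < 0.
Proof.
move=> sx xA d0; rewrite -(pmulr_lgt0 _ (den3_gt0 prm)) apex_drift => H.
have [x0 x1 x2 xs] := simplexP sx.
have k0 := kap_gt0 prm; have k1 := kap_le prm; have dk := detB_le prm.
have rg := rise_ge; have U0 := U_gt0; have CU := driftU.
case: (prm) => r0 r1 f0 f1.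
have k20 : 0 < k ^+ 2 by rewrite exprn_gt0.
pose m := (1 - rho) / 2; pose t := d / k ^+ 2.
have dt : d = k ^+ 2 * t by rewrite /t mulrC divfK // gt_eqF.
have t0 : 0 <= t by rewrite divr_ge0 // ltW.
have t1 : t <= 1 by rewrite ler_pdivrMr // mul1r.
have I : k ^+ 3 * (4 - t) * (k + m * (1 - 2 * k)) + 2 * k ^+ 4 * t * m < m.
  apply: reentry_ineq => //; rewrite /m; try lra.
  move: H; rewrite dt; lra.
have rm : k + m * (1 - 2 * k) = k * rho + m by rewrite /m; field.
have IU : 0 < U * (m - (k ^+ 3 * (4 - t) * (k * rho + m) + 2 * k ^+ 4 * t * m)).
  by rewrite -rm; apply: mulr_gt0; lra.
rewrite (excess_ABBAB xs) (excess_ABB prm xs) (excess_AB prm xs).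
have vx : h (x *m B) <= - k * h x + U * rho.
  have -> : h (x *m B) = - (phi + phi / (1 + rho) - 1) * h x - phi * (1 - rho) / (1 +
    rho) * x 0 1 + U * rho.
    rewrite (excess_B prm xs) /U /pi1; field.
    by rewrite (den1 prm) (den3 prm).
  have : 0 <= phi * (1 - rho) / (1 + rho) * x 0 1.
    by apply: mulr_ge0 => //; apply: divr_ge0; nra.
  have : 0 <= (phi + phi / (1 + rho) - 1 - k) * h x by apply: mulr_ge0; rewrite ?/excess; lra.
  lra.
have hx : 0 <= h x by rewrite /excess subr_ge0.
have : 0 <= k ^+ 2 * (4 * k ^+ 2 - d) * (- k * h x + U * rho - h (x *m B)).
  by apply: mulr_ge0; [apply: mulr_ge0|]; lra.
have : 0 <= k ^+ 3 * (4 * k ^+ 2 - 3 * d) * h x.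
  by apply: mulr_ge0 => //; apply: mulr_ge0; [apply: exprn_ge0|]; lra.
rewrite CU -/m dt; lra.
Qed.

Lemma ABAB_lt0 x : simplex x -> 0 < C + k * apex -> h (x *m A *m B *m A *m B) < 0.
Proof.
move=> sx H; have [x0 x1 x2 xs] := simplexP sx.
have := apex_le sx; rewrite (excess_ABAB xs) -(ler_pM2l (kap_gt0 prm)); lra.
Qed.

Lemma apex_lt0 : 0 <= d -> apex < 0.
Proof.
move=> d0; case: (prm) => r0 r1 f0 f1.
pose s := (1 - phi) / phi; pose v := rho / (1 + rho) ^+ 2.
have q0 : 0 < (1 + rho) ^+ 2 by rewrite exprn_gt0 ?(den1_gt0 prm).
have f00 : 0 < phi by lra.
have := @apex_poly_gt0 R s v.
have -> : 4 * v ^+ 3 - 2 * (1 - 2 * s) * (2 + 3 * s) * v ^+ 2 + (1 + 2 * s - 12 * s ^+ 2 +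
  2 * s ^+ 3) * v - s * (1 - 3 * s + s ^+ 2)
  = - apex * (2 * (1 + rho + rho ^+ 2) * (1 + rho ^+ 2) / (phi ^+ 3 * (1 + rho) ^+ 4)).
  rewrite /apex /s /v /detB /drift /kap /pi0; field.
  by rewrite (den1 prm) (den2 prm) (den3 prm) gt_eqF.
have -> : 2 * v ^+ 2 - (1 - 2 * v) * s * (1 - s) =
  d * ((1 + rho ^+ 2) / (phi ^+ 2 * (1 + rho) ^+ 2)).
  rewrite /s /v /detB; field.
  by rewrite (den1 prm) (den2 prm) gt_eqF.
have p1 := den1_gt0 prm; have p2 := den2_gt0 prm; have p3 := den3_gt0 prm.
rewrite (pmulr_lgt0 (- apex)); last by rewrite divr_gt0 // ?mulr_gt0 ?exprn_gt0.
rewrite oppr_gt0; apply.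
- by apply: divr_ge0; lra.
- by rewrite ltr_pdivrMr //; lra.
- exact: divr_gt0.
- by rewrite ltr_pdivrMr //; nra.
- apply: mulr_ge0 => //; apply: divr_ge0; first exact/ltW/(den2_gt0 prm).
  by rewrite mulr_ge0 // sqr_ge0.
Qed.

(** Regions 9 and 10 both lead to the first hypothesis: in region 9 one has [k < (1 - rho) / 2], and
    in region 10 it comes from [a2_shallow]. *)
Lemma shallow_apex : 2 * k * (k - (1 - rho) / 2) <= d * ((1 - rho) / 2) -> 0 <= d ->
  0 < C + k * apex.
Proof.
move=> H d0; rewrite -(pmulr_lgt0 _ (den3_gt0 prm)) apex_drift.
have k0 := kap_gt0 prm; have k1 := kap_le prm; have dk := detB_le prm.
case: (prm) => r0 r1 f0 f1.
have := @shallow_ineq R k ((1 - rho) / 2) d k0 k1.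
have a1 : 0 < (1 - rho) / 2 by lra.
have a2 : (1 - rho) / 2 < 1 / 2 by lra.
move=> /(_ a1 a2 d0 dk H); lra.
Qed.

End Model.

(** * Translation of the regions *)

Section Regions.
Variables (R : realType) (rho phi : R).
Implicit Type x : 'rV[R]_3.
Local Notation A := (PA phi).
Local Notation B := (PB rho phi).
Local Notation k := (kap phi).
Local Notation C := (drift rho phi).
Local Notation d := (detB rho phi).
Local Notation h := (excess rho).
Local Notation apex := (apex rho phi).

Lemma row3E (a b c : R) : (row3 a b c 0 0 = a) * (row3 a b c 0 1 = b) * (row3 a b c 0 2 = c).
Proof. by rewrite !mxE. Qed.

Lemma mass_row3 (a b c : R) : \sum_i row3 a b c 0 i = a + b + c.
Proof. by rewrite sum_ord3 !row3E. Qed.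

Lemma mul_row3_100 x : (x *m (row3 1 0 0)^T) 0 0 = x 0 0.
Proof. by rewrite mxE sum_ord3 !mxE /=; ring. Qed.

Lemma row3_decomp x : \sum_i x 0 i = 1 ->
  x = x 0 0 *: row3 1 0 (-1) + x 0 1 *: row3 0 1 (-1) + row3 0 0 1.
Proof.
move=> /mass1E e; apply/rowP; apply: ord3P; rewrite ?e !mxE /=; ring.
Qed.

(** Up to sign, [alpha], [beta] and [gamma] are the coefficients of the affine function giving [h]
    after A and [n] times B, in the coordinates [x 0 0] and [x 0 1]. *)
Lemma barycentric n x : \sum_i x 0 i = 1 ->
  gamma rho phi n - alpha rho phi n * x 0 0 - beta rho phi n * x 0 1
  = (-1) ^+ n.-1 * (pi0 rho - (x *m A *m B ^+ n) 0 0).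
Proof.
move=> xs; rewrite /gamma /alpha /beta !mul_row3_100.
have -> : (x *m A *m B ^+ n) 0 0 = x 0 0 * (row3 1 0 (-1) *m A *m B ^+ n) 0 0
    + x 0 1 * (row3 0 1 (-1) *m A *m B ^+ n) 0 0 + (row3 0 0 1 *m A *m B ^+ n) 0 0.
  rewrite [in LHS](row3_decomp xs) !mulmxDl -!scalemxAl.
  by move: (row3 1 0 (-1) *m _ *m _) (row3 0 1 (-1) *m _ *m _) (row3 0 0 1 *m _ *m _) =>
    u v w; rewrite !mxE.
move: (row3 1 0 (-1) *m _ *m _) (row3 0 1 (-1) *m _ *m _) (row3 0 0 1 *m _ *m _) => u v w.
by rewrite !mxE /=; ring.
Qed.

Lemma barycentric1 x : \sum_i x 0 i = 1 ->
  gamma rho phi 1 - alpha rho phi 1 * x 0 0 - beta rho phi 1 * x 0 1 = - h (x *m A *m B).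
Proof. by move=> /barycentric ->; rewrite /excess expr1 mul1r opprB. Qed.

Lemma barycentric2 x : \sum_i x 0 i = 1 ->
  gamma rho phi 2 - alpha rho phi 2 * x 0 0 - beta rho phi 2 * x 0 1 = h (x *m A *m B *m B).
Proof. by move=> /barycentric ->; rewrite /excess expr1 mulN1r opprB expr2 -mulmxE mulmxA. Qed.

Lemma base_region_bounds : base_region rho phi -> [/\ 0 < rho, rho < 1, 2 / 3 < phi & phi <= 1].
Proof. by case=> /andP[? ?] /andP[? ?] _. Qed.

Hypothesis prm : [/\ 0 < rho, rho < 1, 2 / 3 < phi & phi <= 1].

Lemma alpha1_gt0 : 0 < alpha rho phi 1.
Proof.
(* Subtracting the affine function at two vertices isolates one coefficient; [alpha 2] and [beta 2]
   are obtained in the same way. *)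
have m1 : \sum_i row3 1 0 (0:R) 0 i = 1 by rewrite mass_row3 !addr0.
have m3 : \sum_i row3 0 0 (1:R) 0 i = 1 by rewrite mass_row3 !add0r.
have := barycentric1 m1; have := barycentric1 m3.
rewrite !(excess_AB prm) // !(excess_B prm) // /excess !row3E => e1 e2.
have -> : alpha rho phi 1 = k * (phi + phi / (1 + rho) - 1) by lra.
have := kap_gt0 prm; have := rise_ge prm => ? ?; apply: mulr_gt0; lra.
Qed.

Lemma alpha2_gt0 : 0 < alpha rho phi 2.
Proof.
have m1 : \sum_i row3 1 0 (0:R) 0 i = 1 by rewrite mass_row3 !addr0.
have m3 : \sum_i row3 0 0 (1:R) 0 i = 1 by rewrite mass_row3 !add0r.
have := barycentric2 m1; have := barycentric2 m3.
rewrite !(excess_ABB_apex prm) // !row3E => e1 e2.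
have -> : alpha rho phi 2 = k * (2 * k * (phi + phi / (1 + rho) - 1) - d) by lra.
have k0 := kap_gt0 prm; have r0 := rise_ge prm; have d0 := detB_le prm.
apply: mulr_gt0 => //.
have : k * k <= k * (phi + phi / (1 + rho) - 1) by rewrite ler_pM2l.
have : 0 < k * k by apply: mulr_gt0.
lra.
Qed.

Lemma beta2_gt0 : 0 < beta rho phi 2.
Proof.
have m1 : \sum_i row3 0 1 (0:R) 0 i = 1 by rewrite mass_row3 addr0 add0r.
have m3 : \sum_i row3 0 0 (1:R) 0 i = 1 by rewrite mass_row3 !add0r.
have := barycentric2 m1; have := barycentric2 m3.
rewrite !(excess_ABB_apex prm) // !row3E => e1 e2.
have -> : beta rho phi 2 = 2 * k ^+ 2 * (phi * (1 - rho) / (1 + rho)) by lra.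
have k0 := kap_gt0 prm; case: (prm) => r0 r1 f0 f1.
apply: mulr_gt0; first by rewrite mulr_gt0 ?exprn_gt0.
by apply: divr_gt0; [apply: mulr_gt0|]; lra.
Qed.

(** The hypothesis says [alpha 2 <= gamma 2], and [gamma 2 - alpha 2] is [h] after ABB from
    (1,0,0). *)
Lemma apex_ge0 : 1 <= b_ rho phi 2 -> 0 <= apex.
Proof.
rewrite /b_ ler_pdivlMr ?alpha2_gt0 // => H.
have m1 : \sum_i row3 1 0 (0:R) 0 i = 1 by rewrite mass_row3 !addr0.
have := barycentric2 m1; rewrite (excess_ABB_apex prm) // !row3E; lra.
Qed.

(* At the point (b_1, 0, 1 - b_1) one has [h = 0] after AB, so that [h] after
   ABB is a positive multiple both of [detB] and of [b_2 - b_1]. *)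
Lemma detB_ge0 : b_ rho phi 1 <= b_ rho phi 2 -> 0 <= d.
Proof.
move=> H; set b := b_ rho phi 1.
have mb : \sum_i row3 b 0 (1 - b) 0 i = 1 by rewrite mass_row3; ring.
have mp : \sum_i row3 (pi0 rho) 0 (1 - pi0 rho) 0 i = 1 by rewrite mass_row3; ring.
have a1 := alpha1_gt0; have a2 := alpha2_gt0; have k0 := kap_gt0 prm; have C0 := drift_gt0 prm.
have g1 : gamma rho phi 1 = alpha rho phi 1 * b by rewrite /b /b_ mulrC divfK // gt_eqF.
have g2 : gamma rho phi 2 = alpha rho phi 2 * b_ rho phi 2 by rewrite /b_ mulrC divfK // gt_eqF.
(* This makes the factor [k * (b - pi0 rho) + C] of [d] positive at the end. *)
have pib : pi0 rho <= b.
  have := barycentric1 mp; rewrite (excess_AB prm) // (excess_B prm) // /excess !row3E g1 => e.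
  rewrite -subr_ge0 -(pmulr_rge0 _ a1).
  have -> : alpha rho phi 1 * (b - pi0 rho) = k * (phi * (1 - rho) / (1 + rho) * pi1 rho) +
    C by lra.
  have p := pi1_gt0 prm; case: (prm) => r0 r1 f0 f1.
  apply: addr_ge0; last exact: ltW.
  apply: mulr_ge0; first exact: ltW.
  by apply: mulr_ge0; [apply: divr_ge0; nra|exact: ltW].
have ma : \sum_i (row3 b 0 (1 - b) *m A) 0 i = 1 by rewrite mass_mulPA.
have := barycentric2 mb; rewrite (excess_BB prm ma) (excess_A prm mb).
have := barycentric1 mb; rewrite /excess !row3E g1 g2 => e1 e2.
have : 0 <= d * (k * (b - pi0 rho) + C).
  have : 0 <= alpha rho phi 2 * (b_ rho phi 2 - b) by rewrite mulr_ge0 ?subr_ge0 // ltW.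
  have : ((row3 b 0 (1 - b) *m A *m B) 0 0 - pi0 rho) = 0 by lra.
  move: e2 => + e; rewrite e; lra.
rewrite pmulr_lge0 //; apply: ltr_wpDl => //; apply: mulr_ge0; lra.
Qed.


(** Both sides say that [h >= 0] after ABB started at the point (pi0, 1 - pi0, 0). *)
Lemma a2_shallow : 1 - pi0 rho <= a_ rho phi 2 -> 2 * k * (k - (1 - rho) / 2) <=
  d * ((1 - rho) / 2).
Proof.
rewrite /a_ ler_pdivlMr ?beta2_gt0 // => H.
have mp : \sum_i row3 (pi0 rho) (1 - pi0 rho) 0 0 i = 1 by rewrite mass_row3; ring.
have := barycentric2 mp; rewrite (excess_ABB prm) // (excess_B prm) // /excess !row3E => e.
have U0 : 0 < phi * (1 - rho) / (2 * (1 + rho + rho ^+ 2)).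
  by have := den3_gt0 prm; case: (prm) => r0 r1 f0 f1 ?; apply: divr_gt0; [apply: mulr_gt0|];
    lra.
rewrite -subr_ge0 -(pmulr_rge0 _ U0).
have -> : phi * (1 - rho) / (2 * (1 + rho + rho ^+ 2)) * (d * ((1 - rho) / 2) - 2 * k *
  (k - (1 - rho) / 2))
  = 2 * k * (k * ((1 - phi - phi / (1 + rho)) * (pi0 rho - pi0 rho) - phi * (1 - rho) / (1 +
    rho) * (1 - pi0 rho - pi1 rho)) + C) + d * (k * (pi0 rho - pi0 rho) + C).
  move: d => dd; rewrite /drift /pi0 /pi1; field.
  by rewrite (den1 prm) (den3 prm).
rewrite -e; lra.
Qed.

End Regions.

Section Regions2.
Variables (R : realType) (rho phi : R).
Local Notation k := (kap phi).
Local Notation C := (drift rho phi).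
Local Notation d := (detB rho phi).
Local Notation h := (excess rho).
Local Notation apex := (apex rho phi).

Lemma region3_apex : region3 rho phi -> 0 <= apex.
Proof. by case=> base; apply: (apex_ge0 (base_region_bounds base)). Qed.

Lemma region_apex : region9 rho phi \/ region10 rho phi \/ region11 rho phi ->
  [/\ base_region rho phi, 0 <= d & 0 < C + k * apex].
Proof.
rewrite /region9 /region10 /region11 => -[[base]|[[base]|[base]]];
  have prm := base_region_bounds base; case: (prm) => r0 r1 f0 f1; have k0 := kap_gt0 prm.
- move=> /(detB_ge0 prm) d0 f; split => //; apply: shallow_apex => //.
  have : 0 <= d * ((1 - rho) / 2) by apply: mulr_ge0; lra.
  have : 0 <= k * ((1 - rho) / 2 - k) by apply: mulr_ge0; rewrite /kap; lra.
  lra.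
- move=> f /(a2_shallow prm) s.
  (* [1 - rho / 3 <= phi] means [(1 - rho) / 2 <= k], so the left side of [s] is nonnegative. *)
  have d0 : 0 <= d.
    have : 0 <= k * (k - (1 - rho) / 2) by apply: mulr_ge0; rewrite /kap; lra.
    have r2 : 0 < (1 - rho) / 2 by lra.
    by move=> ?; rewrite -(pmulr_lge0 _ r2); lra.
  by split => //; apply: shallow_apex.
- move=> /(detB_ge0 prm) d0 _ f; split => //.
  (* [fvec] is (1,0,0) after AB, so the last condition of region 11 says that [h < 0] after ABAB
     from (1,0,0), where [h] equals [- k * apex - C]. *)
  have m1 : \sum_i row3 1 0 (0:R) 0 i = 1 by rewrite mass_row3 !addr0.
  have mf : \sum_i fvec rho phi 0 i = 1 by rewrite mass_mulPB mass_mulPA.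
  have e : h (fvec rho phi *m PA phi *m PB rho phi) = _ := excess_ABAB prm m1.
  have := barycentric1 rho phi mf; rewrite e (excess_ABB_apex prm m1) !row3E; lra.
Qed.
End Regions2.

(** * Eigenvalues of game B *)

Section Eigen.
Variables (R : realType) (rho phi : R).
Implicit Types x v g : 'rV[R]_3.
Local Notation A := (PA phi).
Local Notation B := (PB rho phi).
Local Notation k := (kap phi).
Local Notation d := (detB rho phi).
Local Notation h := (excess rho).
Local Notation E1 := (e1 rho phi).
Local Notation E2 := (e2 rho phi).

Definition sroot : R := Sroot rho / (1 + rho ^+ 2).
(* On zero-sum vectors, [eform sroot] and [eform (- sroot)] are eigenforms of B
   for [e2] and [e1]. *)
Definition eform (t : R) v : R := (1 + t) * v 0 0 + 2 * v 0 1.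

Hypothesis prm : [/\ 0 < rho, rho < 1, 2 / 3 < phi & phi <= 1].

Lemma Sroot_sqr : Sroot rho ^+ 2 = (1 + rho ^+ 2) * (1 + 4 * rho + rho ^+ 2).
Proof.
by rewrite sqr_sqrtr // mulr_ge0 //; have := den2_gt0 prm; case: (prm) => r0 r1 f0 f1; nra.
Qed.

Lemma sroot_gt0 : 0 < sroot.
Proof.
apply: divr_gt0; last exact: (den2_gt0 prm).
by rewrite sqrtr_gt0 mulr_gt0 //; have := den2_gt0 prm; case: (prm) => r0 r1 f0 f1; nra.
Qed.

Lemma sroot_sqr : sroot ^+ 2 * (1 + rho ^+ 2) = 1 + 4 * rho + rho ^+ 2.
Proof. by rewrite /sroot expr_div_n Sroot_sqr; field; rewrite (den2 prm). Qed.

Lemma sroot_lt2 : sroot < 2.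
Proof.
have := sroot_sqr; have := sroot_gt0; have := den2_gt0 prm; case: (prm) => r0 r1 f0 f1 q s0 e.
rewrite ltNge; apply/negP => h2.
have : 4 <= sroot ^+ 2 by nra.
move=> /(ler_wpM2r (ltW q)); nra.
Qed.

Definition gap : R := phi * (1 - rho) * sroot / (1 + rho).

Lemma e1E : E1 = - k + gap / 2.
Proof. by rewrite /e1 /gap /kap /sroot; field; rewrite (den1 prm) (den2 prm). Qed.

Lemma e2E : E2 = - k - gap / 2.
Proof. by rewrite /e2 /gap /kap /sroot; field; rewrite (den1 prm) (den2 prm). Qed.

Lemma gap_gt0 : 0 < gap.
Proof.
have := den1_gt0 prm; have := sroot_gt0; case: (prm) => r0 r1 f0 f1 s0 q.
have p0 : 0 < phi by lra.
have p1 : 0 < 1 - rho by lra.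
by apply: divr_gt0 => //; apply: mulr_gt0 => //; apply: mulr_gt0.
Qed.

Lemma gap_lt1 : gap < 1.
Proof.
have q1 := den1_gt0 prm; have q2 := den2_gt0 prm; have s0 := sroot_gt0; have ss := sroot_sqr.
case: (prm) => r0 r1 f0 f1.
have : (1 - rho) * sroot < 1 + rho.
  rewrite ltNge; apply/negP => H.
  have : (1 + rho) ^+ 2 <= ((1 - rho) * sroot) ^+ 2.
    by rewrite lerXn2r // ?nnegrE; [lra|rewrite mulr_ge0 // ?ltW //; lra].
  rewrite -(ler_pM2r q2) exprMn -[(1 - rho) ^+ 2 * _ * _]mulrA ss.
  rewrite -subr_ge0 (_ : _ - _ = - (8 * rho ^+ 2)); last ring.
  by rewrite oppr_ge0 leNgt mulr_gt0 ?exprn_gt0.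
rewrite /gap ltr_pdivrMr // mul1r; apply: le_lt_trans.
have : 0 <= (1 - rho) * sroot by rewrite mulr_ge0 //; lra.
by rewrite -mulrA; nra.
Qed.

Lemma e1_mul_e2 : E1 * E2 = d.
Proof.
rewrite e1E e2E; have -> : (- k + gap / 2) * (- k - gap / 2) = k ^+ 2 - gap ^+ 2 / 4 by field.
have -> : gap ^+ 2 = phi ^+ 2 * (1 - rho) ^+ 2 * (sroot ^+ 2 * (1 + rho ^+ 2)) / ((1 +
  rho) ^+ 2 * (1 + rho ^+ 2)).
  by rewrite /gap; field; rewrite (den1 prm) (den2 prm).
by rewrite sroot_sqr /kap /detB; field; rewrite (den1 prm) (den2 prm).
Qed.

Lemma eform_B t e v : \sum_i v 0 i = 0 ->
  t ^+ 2 * (1 + rho ^+ 2) = 1 + 4 * rho + rho ^+ 2 ->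
  e = - k - phi * (1 - rho) * t / (2 * (1 + rho)) ->
  eform t (v *m B) = e * eform t v.
Proof.
rewrite sum_ord3 => /eqP; rewrite addr_eq0 => /eqP v2 tt ->.
rewrite /eform mulPB0 mulPB1.
have -> : v 0 2 = - (v 0 0 + v 0 1) by rewrite v2 opprK.
apply/eqP; rewrite -subr_eq0; apply/eqP.
(* The defect in the eigenform equation is a multiple of the quadratic equation assumed for [t]. *)
transitivity (phi * (1 - rho) / (2 * (1 + rho) * (1 + rho ^+ 2)) * (t ^+ 2 * (1 +
  rho ^+ 2) - (1 + 4 * rho + rho ^+ 2)) * v 0 0).
  by rewrite /p0 /p1 /kap; field; rewrite (den1 prm) (den2 prm).
by rewrite tt subrr mulr0 mul0r.
Qed.

Lemma e2_lt0 : E2 < 0.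
Proof. by rewrite e2E; have := kap_gt0 prm; have := gap_gt0; lra. Qed.

Lemma e1_lt_e2 : `|E1| < - E2.
Proof.
rewrite e1E e2E; have := kap_gt0 prm; have := gap_gt0 => g0 k0.
by rewrite ltr_norml; apply/andP; split; lra.
Qed.

(** The left side is the larger of [gap] and [2 * kap], and neither exceeds 1. *)
Lemma e1_add_e2 : `|E1| + - E2 <= 1.
Proof.
rewrite -lerBrDr e1E e2E; have := kap_gt0 prm; have := kap_le prm; have := gap_gt0.
move: gap_lt1 => g1 g0 k1 k0; rewrite ler_norml; apply/andP; split; lra.
Qed.

(** Put [x = e1 ^+ 2] and [y = e2 ^+ 2]. Multiplying [0 < G42] by [(1 + k * x) * (1 + k * y)] leaves
    surplus factors on the two sides; they compare in the right direction ([q] below) thanks to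
    [sextic_le]. *)
Lemma G42_lt : 0 < G42 rho phi ->
  E1 ^+ 2 * Kplus rho * (1 + k * E2 ^+ 2) < E2 ^+ 2 * Kminus rho * (1 + k * E1 ^+ 2).
Proof.
have -> : G42 rho phi = 8 * (phi * (1 - rho)) *
  (E2 ^+ 2 * Kminus rho * ((1 - k * E2 ^+ 2) * (1 - k ^+ 2 * E1 ^+ 6))
   - E1 ^+ 2 * Kplus rho * ((1 - k * E1 ^+ 2) * (1 - k ^+ 2 * E2 ^+ 6))).
  by rewrite /G42 (_ : 3 * phi - 2 = 2 * k); [ring|rewrite /kap; field].
case: (prm) => r0 r1 f0 f1.
have fr : 0 < 8 * (phi * (1 - rho)) by rewrite !mulr_gt0 //; lra.
rewrite (pmulr_rgt0 _ fr) subr_gt0.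
have k0 := kap_gt0 prm; have k1 := kap_le prm.
set a : R := `|E1|; set b : R := - E2.
have -> : E1 ^+ 2 = a ^+ 2 by rewrite /a real_normK // num_real.
have -> : E1 ^+ 6 = a ^+ 6 by rewrite (exprM E1 2 3) (exprM a 2 3) /a real_normK // num_real.
have -> : E2 ^+ 2 = b ^+ 2 by rewrite /b sqrrN.
have -> : E2 ^+ 6 = b ^+ 6 by rewrite (exprM E2 2 3) (exprM b 2 3) /b sqrrN.
have a0 : 0 <= a by exact: normr_ge0.
have ab : a < b := e1_lt_e2.
have ab1 : a + b <= 1 := e1_add_e2.
have b0 : 0 < b by lra.
have Kp : 0 < Kplus rho.
  rewrite /Kplus; have q1 := den1_gt0 prm; have q2 := den2_gt0 prm.
  apply: ltr_wpDr; first by rewrite mulr_ge0 ?sqrtr_ge0 //; lra.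
  by rewrite !mulr_gt0.
have I := sextic_le a0 (ltW ab) ab1.
have a2 : a ^+ 2 <= b ^+ 2 by rewrite lerXn2r // ?nnegrE; lra.
have b2 : b ^+ 2 <= 1 by rewrite exprn_ile1 //; lra.
set x := a ^+ 2 in a2 *; set y := b ^+ 2 in a2 b2 *.
have x0 : 0 <= x by rewrite sqr_ge0.
have ex : a ^+ 6 = x ^+ 3 by rewrite (exprM _ 2 3).
have ey : b ^+ 6 = y ^+ 3 by rewrite (exprM _ 2 3).
have I' : x ^+ 2 * (1 - x) <= y ^+ 2 * (1 - y) by rewrite -!exprM.
rewrite ex ey => G.
have p1 : 0 < 1 - k ^+ 2 * x ^+ 3.
  have : x ^+ 3 <= 1 by rewrite exprn_ile1 //; lra.
  have : 0 <= x ^+ 3 by rewrite exprn_ge0.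
  have : k ^+ 2 <= 1 / 4 by nra.
  nra.
have p2 : 0 < 1 - k ^+ 2 * y ^+ 2.
  have : y ^+ 2 <= 1 by rewrite exprn_ile1 //; lra.
  have : 0 <= y ^+ 2 by rewrite sqr_ge0.
  have : k ^+ 2 <= 1 / 4 by nra.
  nra.
have q : (1 - k ^+ 2 * x ^+ 3) * (1 - k ^+ 2 * y ^+ 2) <=
  (1 - k ^+ 2 * y ^+ 3) * (1 - k ^+ 2 * x ^+ 2).
  rewrite -subr_ge0.
  have -> : (1 - k ^+ 2 * y ^+ 3) * (1 - k ^+ 2 * x ^+ 2) - (1 - k ^+ 2 * x ^+ 3) *
    (1 - k ^+ 2 * y ^+ 2)
    = k ^+ 2 * ((y ^+ 2 * (1 - y) - x ^+ 2 * (1 - x)) +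
      k ^+ 2 * x ^+ 2 * y ^+ 2 * (y - x)) by ring.
  apply: mulr_ge0; first exact: sqr_ge0.
  apply: addr_ge0; first by rewrite subr_ge0.
  apply: mulr_ge0; last by rewrite subr_ge0.
  by apply: mulr_ge0; [apply: mulr_ge0|]; exact: sqr_ge0.
rewrite -(ltr_pM2r (mulr_gt0 p1 p2)).
have kx : 0 < 1 + k * x by apply: ltr_pwDl => //; rewrite mulr_ge0 // ltW.
have y0 : 0 <= y by rewrite sqr_ge0.
have ky : 0 < 1 + k * y by apply: ltr_pwDl => //; rewrite mulr_ge0 // ltW.
have : x * Kplus rho * (1 + k * y) * ((1 - k ^+ 2 * x ^+ 3) * (1 - k ^+ 2 * y ^+ 2))
  <= x * Kplus rho * (1 + k * y) * ((1 - k ^+ 2 * y ^+ 3) * (1 - k ^+ 2 * x ^+ 2)).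
  by apply: ler_wpM2l => //; rewrite !mulr_ge0 // ltW.
move/le_lt_trans; apply.
move: G; rewrite -(ltr_pM2r (mulr_gt0 kx ky)); lra.
Qed.

Lemma piB_fix : piB rho *m B = piB rho.
Proof.
apply/rowP; apply: ord3P; rewrite (mulPB0, mulPB1, mulPB2) !row3E /p0 /p1 /pi0 /pi1 /pi2; field;
  by rewrite (den1 prm) ?(den2 prm) (den3 prm).
Qed.

(** The two eigenforms split the fixed-point equation into scalar equations that are solved
    explicitly. The difference of the two forms at [g - piB] is [2 * sroot * h g], and its sign is
    [G42_lt]. *)
Lemma excess_cycle_gt0 g : 0 < G42 rho phi -> \sum_i g 0 i = 1 ->
  g *m A *m B *m B = g -> 0 < h g.
Proof.
move=> G gs gE; have LT := G42_lt G.
have s0 := sroot_gt0; have k0 := kap_gt0 prm.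
have pis : \sum_i piB rho 0 i = 1 by rewrite mass_row3 (pi_sum prm).
have massB x : \sum_i x 0 i = 1 -> \sum_i (x - piB rho) 0 i = 0.
  by move=> xs; under eq_bigr do rewrite !mxE; rewrite sumrB xs; move: pis;
    under eq_bigr do rewrite !mxE; move=> ->; rewrite subrr.
have gAs : \sum_i (g *m A) 0 i = 1 by rewrite mass_mulPA.
have gABs : \sum_i (g *m A *m B) 0 i = 1 by rewrite mass_mulPB.
(* The form at [g - piB] is [e ^+ 2] times the form at [g *m A - piB], and the latter is [- k] times
   the former plus a constant. *)
have key t e : t ^+ 2 * (1 + rho ^+ 2) = 1 + 4 * rho + rho ^+ 2 ->
    e = - k - phi * (1 - rho) * t / (2 * (1 + rho)) ->
    eform t (g - piB rho) * (1 + k * e ^+ 2) =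
    e ^+ 2 * (phi * (1 - rho) / (4 * (1 + rho + rho ^+ 2) * (1 + rho ^+ 2))
      * (3 * (1 + rho) * (1 + rho ^+ 2) - (1 - rho) * (t * (1 + rho ^+ 2)))).
  move=> tt et.
  have e1' : g - piB rho = (g *m A - piB rho) *m B *m B by rewrite !mulmxBl gE !piB_fix.
  have := eform_B (massB _ gABs) tt et.
  rewrite (_ : (g *m A *m B - piB rho) *m B = g - piB rho); last by rewrite mulmxBl gE piB_fix.
  rewrite (_ : g *m A *m B - piB rho = (g *m A - piB rho) *m B);
    last by rewrite mulmxBl piB_fix.
  rewrite (eform_B (massB _ gAs) tt et) => H.
  rewrite {1}/eform.
  have -> : eform t (g - piB rho) * (1 + k * e ^+ 2) =
    eform t (g - piB rho) + k * e ^+ 2 * eform t (g - piB rho) by ring.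
  rewrite {1}H; rewrite /eform ![(_ - piB rho) 0 _]mxE !mulPA gs.
  rewrite ![(- piB rho) 0 _]mxE !row3E /kap /pi0 /pi1; field.
  by rewrite (den2 prm) (den3 prm).
have Ss : sroot * (1 + rho ^+ 2) = Sroot rho by rewrite /sroot divfK // (den2 prm).
have q2 : eform sroot (g - piB rho) * (1 + k * E2 ^+ 2) =
    E2 ^+ 2 * (phi * (1 - rho) / (4 * (1 + rho + rho ^+ 2) * (1 + rho ^+ 2)) * Kminus rho).
  rewrite (key _ _ sroot_sqr) ?Ss // e2E /gap; field.
  exact: (den1 prm).
have q1 : eform (- sroot) (g - piB rho) * (1 + k * E1 ^+ 2) =
    E1 ^+ 2 * (phi * (1 - rho) / (4 * (1 + rho + rho ^+ 2) * (1 + rho ^+ 2)) * Kplus rho).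
  rewrite (key (- sroot) E1) ?sqrrN ?sroot_sqr // ?mulNr ?Ss ?mulrN ?opprK // e1E /gap; field.
  exact: (den1 prm).
have D0 : 0 < phi * (1 - rho) / (4 * (1 + rho + rho ^+ 2) * (1 + rho ^+ 2)).
  have d2 := den2_gt0 prm; have d3 := den3_gt0 prm; case: (prm) => r0 r1 f0 f1.
  by apply: divr_gt0; rewrite !mulr_gt0 //; lra.
have m1 : 0 < 1 + k * E1 ^+ 2 by apply: ltr_pwDl => //; rewrite mulr_ge0 ?sqr_ge0 // ltW.
have m2 : 0 < 1 + k * E2 ^+ 2 by apply: ltr_pwDl => //; rewrite mulr_ge0 ?sqr_ge0 // ltW.
have : eform (- sroot) (g - piB rho) < eform sroot (g - piB rho).
  rewrite -(ltr_pM2r m1) -(ltr_pM2r m2) q1.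
  rewrite [ltRHS]mulrAC q2.
  rewrite -(ltr_pM2l D0) in LT; lra.
rewrite /eform -subr_gt0.
have -> : (1 + sroot) * (g - piB rho) 0 0 + 2 * (g - piB rho) 0 1 - ((1 +
  - sroot) * (g - piB rho) 0 0 + 2 * (g - piB rho) 0 1)
  = 2 * sroot * (g - piB rho) 0 0 by ring.
have s2 : 0 < 2 * sroot by rewrite mulr_gt0.
rewrite (pmulr_rgt0 _ s2).
by rewrite mxE [(- piB rho) 0 0]mxE row3E.
Qed.

End Eigen.

(** * Contraction *)

Section L1norm.
Variable R : realType.
Implicit Types x v : 'rV[R]_3.

Definition l1 v : R := \sum_i `|v 0 i|.

Lemma l1_ge0 v : 0 <= l1 v. Proof. by apply: sumr_ge0 => i _; apply: normr_ge0. Qed.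

Lemma coord_le_l1 v i : `|v 0 i| <= l1 v.
Proof. by rewrite /l1 (bigD1 i) //= lerDl; apply: sumr_ge0 => j _; apply: normr_ge0. Qed.

Lemma l1_eq0 v : l1 v = 0 -> v = 0.
Proof.
move=> e; apply/rowP => i; rewrite mxE; apply/eqP; rewrite -normr_le0 -e; exact: coord_le_l1.
Qed.

Lemma coord_le_norm v i : `|v 0 i| <= `|v|.
Proof.
rewrite [leRHS]mx_normrE.
exact: (le_bigmax _ (fun ij : 'I_1 * 'I_3 => `|v ij.1 ij.2|) (0, i)).
Qed.

Lemma norm_le_l1 v : `|v| <= l1 v.
Proof.
rewrite [leLHS]mx_normrE; apply/bigmax_leP; split; first exact: l1_ge0.
by case=> i j _ /=; rewrite (ord1 i); exact: coord_le_l1.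
Qed.

Lemma l1_le_norm v : l1 v <= 3 * `|v|.
Proof.
have h i := coord_le_norm v i.
by rewrite /l1 sum_ord3; have := h 0; have := h 1; have := h 2; lra.
Qed.

Definition stochastic (M : 'M[R]_3) :=
  (forall i j, 0 <= M i j) /\ forall i, \sum_j M i j = 1.

Lemma l1_stochastic M v : stochastic M -> l1 (v *m M) <= l1 v.
Proof.
move=> [M0 M1]; rewrite /l1.
have e : \sum_i `|v 0 i| = \sum_j \sum_i `|v 0 i| * M i j.
  by rewrite exchange_big; apply: eq_bigr => i _; rewrite -mulr_sumr M1 mulr1.
rewrite e; apply: ler_sum => j _; rewrite mxE.
apply: le_trans (ler_norm_sum _ _ _) _; apply: ler_sum => i _.
by rewrite normrM (ger0_norm (M0 i j)).
Qed.

Lemma simplex_stochastic M x : stochastic M -> simplex x -> simplex (x *m M).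
Proof.
move=> [M0 M1] [x0 x1]; split => [j|].
  by rewrite mxE; apply: sumr_ge0 => i _; apply: mulr_ge0.
rewrite -x1; under eq_bigr do rewrite mxE.
by rewrite exchange_big; apply: eq_bigr => i _; rewrite -mulr_sumr M1 mulr1.
Qed.

Lemma geometric_small (r K e : R) : 0 <= r -> r < 1 -> 0 < e ->
  exists N, forall n, (N <= n)%N -> K * r ^+ n < e.
Proof.
move=> r0 r1 e0.
have /cvgrPdist_lt c : r ^+ n @[n --> \oo] --> (0:R) by apply: cvg_expr; rewrite ger0_norm.
have K1 : 0 < `|K| + 1 by rewrite ltr_wpDl.
have [N _ HN] := c _ (divr_gt0 e0 K1).
exists N => n /HN; rewrite /= sub0r normrN ger0_norm ?exprn_ge0 // ltr_pdivlMr // => H.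
apply: le_lt_trans H; rewrite mulrC; apply: ler_wpM2l; first exact: exprn_ge0.
by apply: le_trans (ler_norm K) _; rewrite lerDl.
Qed.
End L1norm.

(** * Trajectories repeating ABB, and the fixed point of ABB *)

Section Dynamics.
Variables (R : realType) (rho phi : R).
Implicit Types x y v g : 'rV[R]_3.
Local Notation A := (PA phi).
Local Notation B := (PB rho phi).
Local Notation h := (excess rho).
Local Notation F := (F rho phi).
Local Notation traj := (traj rho phi).
Local Notation rep := (Delta_rep rho phi [::] [:: gA; gB; gB]).

Lemma game_atA x : 0 <= h x -> game_at rho x = gA.
Proof. by rewrite /game_at /excess subr_ge0 => ->. Qed.

Lemma game_atB x : h x < 0 -> game_at rho x = gB.
Proof. by rewrite /game_at /excess subr_lt0 ltNge => /negbTE ->. Qed.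

Lemma game_atP x : (game_at rho x = gA /\ 0 <= h x) \/ (game_at rho x = gB /\ h x < 0).
Proof.
have [H|H] := lerP 0 (h x); [left|right]; split=> //; [exact: game_atA|exact: game_atB].
Qed.

Lemma game_at_A x : game_at rho x = gA -> 0 <= h x.
Proof. by case: (game_atP x) => -[-> //]. Qed.

Lemma game_at_B x : game_at rho x = gB -> h x < 0.
Proof. by case: (game_atP x) => -[-> //]. Qed.

Lemma FA x : 0 <= h x -> F x = x *m A.
Proof. by move=> H; rewrite /Defs.F game_atA. Qed.

Lemma FB x : h x < 0 -> F x = x *m B.
Proof. by move=> H; rewrite /Defs.F game_atB. Qed.

Lemma trajS x n : traj x n.+1 = traj (F x) n.
Proof. by rewrite /Defs.traj iterSr. Qed.

Lemma trajD x m n : traj x (m + n) = traj (traj x n) m.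
Proof. by rewrite /Defs.traj iterD. Qed.

Lemma traj1 x : traj x 1 = F x. Proof. by []. Qed.

Hypothesis prm : [/\ 0 < rho, rho < 1, 2 / 3 < phi & phi <= 1].

Lemma PA_stochastic : stochastic A.
Proof.
case: (prm) => r0 r1 f0 f1; split.
  by apply: ord3P; apply: ord3P; rewrite !mxE /=; lra.
by apply: ord3P; rewrite sum_ord3 !mxE /=; field.
Qed.

Lemma PB_stochastic : stochastic B.
Proof.
case: (prm) => r0 r1 f0 f1; have q1 := den1_gt0 prm; have q2 := den2_gt0 prm.
have [a0 a1] : 0 <= p0 rho /\ p0 rho <= 1.
  split; first by apply: divr_ge0; [exact: sqr_ge0|exact: ltW].
  by rewrite ler_pdivrMr // mul1r lerDr.
have [b0 b1] : 0 <= p1 rho /\ p1 rho <= 1.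
  split; first by apply: divr_ge0 => //; exact: ltW.
  by rewrite ler_pdivrMr // mul1r lerDl ltW.
have c0 : 0 <= phi * p0 rho by apply: mulr_ge0; lra.
have c1 : 0 <= phi * (1 - p0 rho) by apply: mulr_ge0; lra.
have c2 : 0 <= phi * p1 rho by apply: mulr_ge0; lra.
have c3 : 0 <= phi * (1 - p1 rho) by apply: mulr_ge0; lra.
split.
  by apply: ord3P; apply: ord3P; rewrite !mxE /=; lra.
by apply: ord3P; rewrite sum_ord3 !mxE /=; ring.
Qed.

Lemma simplex_F x : simplex x -> simplex (F x).
Proof.
rewrite /Defs.F; case: game_at => sx; apply: simplex_stochastic => //.
  exact: PA_stochastic.
exact: PB_stochastic.
Qed.

Lemma simplex_traj x n : simplex x -> simplex (traj x n).
Proof. by elim: n x => [//|n IH] x sx; rewrite trajS; apply: IH; apply: simplex_F. Qed.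

Lemma simplex_diff x y : simplex x -> simplex y -> \sum_i (x - y) 0 i = 0.
Proof.
move=> [_ xs] [_ ys]; under eq_bigr do rewrite mxE [(- y) _ _]mxE.
by rewrite sumrB xs ys subrr.
Qed.

Lemma mass_subZ (c : R) x y : \sum_i (x - c *: y) 0 i = \sum_i x 0 i - c * \sum_i y 0 i.
Proof. by under eq_bigr do rewrite !mxE; rewrite sumrB -mulr_sumr. Qed.

Lemma l1_A v : \sum_i v 0 i = 0 -> l1 (v *m A) <= l1 v / 2.
Proof.
move=> v0; rewrite /l1 mulr_suml; apply: ler_sum => i _.
rewrite mulPA v0 mulr0 addr0 normrM mulrC ler_wpM2l // ler_norml.
by case: (prm) => r0 r1 f0 f1; apply/andP; split; lra.
Qed.

Lemma l1_F_same x y : game_at rho x = game_at rho y -> l1 (F x - F y) <= l1 (x - y).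
Proof.
rewrite /Defs.F => ->; case: game_at; rewrite -mulmxBl; apply: l1_stochastic.
  exact: PA_stochastic.
exact: PB_stochastic.
Qed.

Lemma l1_traj_same x y n : (forall m, (m < n)%N ->
  game_at rho (traj x m) = game_at rho (traj y m)) ->
  l1 (traj x n - traj y n) <= l1 (x - y).
Proof.
elim: n => [//|n IH] H; rewrite /Defs.traj !iterS.
apply: le_trans (l1_F_same (H n _)) _ => //.
by apply: IH => m mn; apply: H; apply: leq_trans mn _.
Qed.

Lemma excess_lt_after_A x : simplex x -> 0 <= h x -> h (x *m A) < 0.
Proof.
move=> [_ xs] hx; rewrite (excess_A prm xs).
by have := mulr_ge0 (ltW (kap_gt0 prm)) hx; have := drift_gt0 prm; lra.
Qed.

Lemma rep_step x : rep x ->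
  [/\ simplex x, 0 <= h x, h (x *m A) < 0, h (x *m A *m B) < 0 & rep (x *m A *m B *m B)]
  /\ traj x 3 = x *m A *m B *m B.
Proof.
move=> [sx Hx].
have h0 : 0 <= h x by apply: game_at_A; exact: (Hx 0%N).
have e1 : traj x 1 = x *m A by rewrite traj1 FA.
have h1 : h (x *m A) < 0 by apply: game_at_B; rewrite -e1; exact: (Hx 1%N).
have e2 : traj x 2 = x *m A *m B by rewrite trajS FA // traj1 FB.
have h2 : h (x *m A *m B) < 0 by apply: game_at_B; rewrite -e2; exact: (Hx 2%N).
have e3 : traj x 3 = x *m A *m B *m B by rewrite trajS FA // trajS FB // traj1 FB.
split => //; split => //; rewrite -e3; split; first exact: simplex_traj.
by move=> n; rewrite -trajD Hx /= !subn0 modnDr.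
Qed.

(** A coinduction principle: [P] serves as an invariant checked once per period. *)
Lemma rep_intro (P : set 'rV[R]_3) :
  (forall x, P x -> [/\ simplex x, 0 <= h x, h (x *m A) < 0, h (x *m A *m B) <
    0 & P (x *m A *m B *m B)]) ->
  P `<=` rep.
Proof.
move=> H x Px; split; first by case: (H _ Px).
move=> n; rewrite /= subn0 (divn_eq n 3); move: (n %/ 3)%N (n %% 3)%N (ltn_mod n 3) => m r.
rewrite /= => r3; rewrite modnMDl (modn_small r3) addnC trajD.
have : P (traj x (m * 3)).
  elim: m => [//|m IH]; rewrite mulSn trajD; have [sy h0 h1 h2] := H _ IH.
  by rewrite trajS FA // trajS FB // traj1 FB.
move: (traj x _) => y /H[sy h0 h1 h2 _].
case: r r3 => [|[|[|//]]] _; first by rewrite game_atA.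
  by rewrite traj1 FA // game_atB.
by rewrite trajS FA // traj1 FB // game_atB.
Qed.

Lemma rep_contract x y n : rep x -> rep y ->
  l1 (traj x (n * 3) - traj y (n * 3)) <= l1 (x - y) * (1 / 2) ^+ n.
Proof.
elim: n x y => [|n IH] x y rx ry; first by rewrite expr0 mulr1.
have [[sx _ _ _ rx'] ex] := rep_step rx.
have [[sy _ _ _ ry'] ey] := rep_step ry.
rewrite mulSnr !trajD ex ey; apply: le_trans (IH _ _ rx' ry') _.
rewrite exprS mulrA ler_wpM2r ?exprn_ge0 // -!mulmxBl; try lra.
apply: le_trans (l1_stochastic _ PB_stochastic) _.
apply: le_trans (l1_stochastic _ PB_stochastic) _.
by apply: le_trans (l1_A (simplex_diff sx sy)) _; rewrite mul1r.
Qed.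

Lemma rep_same x y : rep x -> rep y -> forall n, game_at rho (traj x n) =
  game_at rho (traj y n).
Proof. by move=> [_ Hx] [_ Hy] n; rewrite Hx Hy. Qed.

Lemma l1_rep x y m n : rep x -> rep y -> (n * 3 <= m)%N ->
  l1 (traj x m - traj y m) <= l1 (x - y) * (1 / 2) ^+ n.
Proof.
move=> rx ry nm; rewrite -(subnK nm) !trajD.
apply: le_trans (rep_contract n rx ry); apply: l1_traj_same => p _.
by rewrite -!trajD; apply: rep_same.
Qed.

Lemma approaches_rep x g : rep x -> rep g -> approaches rho phi x (range (traj g)).
Proof.
move=> rx rg e e0.
have [||N HN] := @geometric_small R (1/2) (l1 (x - g)) e _ _ e0; try lra.
near=> n; exists (traj g n); first by exists n.
apply: le_lt_trans (norm_le_l1 _) _; apply: le_lt_trans (HN N (leqnn N)).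
apply: l1_rep => //; near: n; exact: nbhs_infty_ge.
Unshelve. all: end_near. Qed.

Lemma approaches_shift x m G : approaches rho phi (traj x m) G -> approaches rho phi x G.
Proof.
move=> H e /H [N _ HN]; exists (N + m)%N => // n /= nN.
have mn : (m <= n)%N by apply: leq_trans nN; apply: leq_addl.
by rewrite -(subnK mn) trajD; apply: HN => /=; rewrite leq_subRL // addnC.
Qed.

(* If [g] is the fixed vector of mass one, [|g|] is fixed too, hence is a
   multiple of [g] because ABB contracts zero-sum vectors; so [g >= 0]. *)
Lemma cycle_exists : exists g, simplex g /\ g *m A *m B *m B = g.
Proof.
pose T := A *m B *m B.
(* The rows of [T] sum to one, so [T] fixes the constant column; hence [T - 1] is singular and has a
   nonzero row vector [v] in its left kernel. *)
have /det0P[v v0 vT] : \det (T - 1%:M) == 0.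
  rewrite -det_tr; apply/det0P; exists (const_mx 1).
    by apply/eqP => /rowP/(_ 0); rewrite !mxE => /eqP; rewrite oner_eq0.
  have st M : stochastic M -> M *m (const_mx 1 : 'cV[R]_3) = const_mx 1.
    by move=> [_ M1]; apply/colP => i; rewrite !mxE -[RHS](M1 i); apply: eq_bigr => j _;
      rewrite mxE mulr1.
  rewrite -trmx_const -trmx_mul mulmxBl mul1mx /T -!mulmxA !st ?subrr ?trmx0 //.
    exact: PA_stochastic.
  1,2: exact: PB_stochastic.
have {}vT : v *m A *m B *m B = v.
  by move/eqP: vT; rewrite mulmxBr mulmx1 subr_eq0 /T !mulmxA => /eqP.
have fix0 (z : 'rV[R]_3) : \sum_i z 0 i = 0 -> z *m A *m B *m B = z -> z = 0.
  move=> z0 zT; apply: l1_eq0; apply/eqP; rewrite eq_le l1_ge0 andbT.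
  have : l1 z <= l1 z / 2.
    rewrite -[X in l1 X <= _]zT.
    apply: le_trans (l1_stochastic _ PB_stochastic) _.
    by apply: le_trans (l1_stochastic _ PB_stochastic) _; apply: l1_A.
  lra.
have vs : \sum_i v 0 i != 0 by apply: contra_neqN v0 => /eqP /fix0 ->.
set s := \sum_i v 0 i in vs.
have [g [gs gT]] : exists g : 'rV[R]_3, \sum_i g 0 i = 1 /\ g *m A *m B *m B = g.
  exists (s^-1 *: v); split; last by rewrite -!scalemxAl vT.
  by under eq_bigr do rewrite mxE; rewrite -mulr_sumr mulVf.
exists g; split => //; split => // i.
have TT : stochastic T.
  split => [a b|a].
    rewrite /T mxE; apply: sumr_ge0 => c _; apply: mulr_ge0; last by case: PB_stochastic.
    rewrite mxE; apply: sumr_ge0 => c' _; apply: mulr_ge0; first by case: PA_stochastic.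
    by case: PB_stochastic.
  have : simplex (delta_mx 0 a *m A *m B *m B).
    do 2 (apply: simplex_stochastic; first exact: PB_stochastic).
    apply: simplex_stochastic; first exact: PA_stochastic.
    split => [b|]; first by rewrite mxE ler0n.
    by rewrite (bigD1 a) //= big1 ?addr0 ?mxE ?eqxx // => b ba; rewrite mxE (negbTE ba) andbF.
  move=> [_]; rewrite -!mulmxA; under eq_bigr do rewrite -rowE mxE; by rewrite /T mulmxA.
pose u : 'rV[R]_3 := \row_j `|g 0 j|.
have gT' : g *m T = g by rewrite /T !mulmxA.
(* The triangle inequality coordinate by coordinate; as [u] and [u *m T] have equal mass, equality
   must hold everywhere. *)
have le j : u 0 j <= (u *m T) 0 j.
  rewrite mxE -{1}gT' mxE [leRHS]mxE; apply: le_trans (ler_norm_sum _ _ _) _.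
  apply: ler_sum => c _; by rewrite normrM (ger0_norm (TT.1 c j)) [u 0 c]mxE.
have us : \sum_j (u *m T) 0 j =
  \sum_j u 0 j by rewrite /T !mulmxA mass_mulPB mass_mulPB mass_mulPA.
have uT : u *m T = u.
  apply/rowP; move: us; rewrite !sum_ord3 => us.
  by have := le 0; have := le 1; have := le 2 => l2 l1' l0; apply: ord3P; lra.
have uT' : u *m A *m B *m B = u by rewrite -[RHS]uT /T !mulmxA.
have us1 : 1 <= \sum_j u 0 j.
  by rewrite -gs; apply: ler_sum => j _; rewrite mxE ler_norm.
have : u - (\sum_j u 0 j) *: g = 0.
  apply: fix0.
    by rewrite mass_subZ gs mulr1 subrr.
  by rewrite !mulmxBl -!scalemxAl gT uT'.
move/eqP; rewrite subr_eq0 => /eqP/rowP/(_ i); rewrite !mxE => e.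
have := normr_ge0 (g 0 i); rewrite e pmulr_rge0 //.
by apply: lt_le_trans us1.
Qed.

End Dynamics.

(** * Attraction and stability of the cycle *)

Section Cycle.
Variables (R : realType) (rho phi : R).
Implicit Types x y v g : 'rV[R]_3.
Local Notation A := (PA phi).
Local Notation B := (PB rho phi).
Local Notation h := (excess rho).
Local Notation traj := (traj rho phi).
Local Notation rep := (Delta_rep rho phi [::] [:: gA; gB; gB]).
Hypothesis prm : [/\ 0 < rho, rho < 1, 2 / 3 < phi & phi <= 1].
Variable g : 'rV[R]_3.
Hypothesis rg : rep g.
Hypothesis gT : g *m A *m B *m B = g.
Local Notation G := (range (traj g)).

Lemma traj_cycle n m : traj g (n + m * 3) = traj g n.
Proof.
have [_ e3] := rep_step prm rg; rewrite gT in e3.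
by elim: m => [|m IH]; rewrite ?addn0 // mulSnr addnA trajD e3 IH.
Qed.

Lemma cycle_limit_cycle : limit_cycle rho phi G.
Proof.
exists g, 3%N; split => //; first by case: rg.
by have := traj_cycle 0 1; rewrite add0n mul1n.
Qed.

Lemma cycle_form12 : form12 rho phi G.
Proof. by exists g => //; exists 0%N. Qed.

Lemma periodic x p m : traj x p = x -> traj x (m * p) = x.
Proof. by move=> e; elim: m => [//|m IH]; rewrite mulSn trajD IH. Qed.

(** After [p * 3] steps, a multiple of both periods, [traj x n] and [g] return to themselves, yet
    their distance has shrunk; so they coincide. *)
Lemma cycle_unique x p n : (0 < p)%N -> traj x p = x -> rep (traj x n) -> range (traj x) = G.
Proof.
move=> p0 xp rx.
have yg : traj x n = g.
  have y3 : traj (traj x n) (p * 3) = traj x n.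
    by rewrite mulnC; apply: periodic; rewrite -trajD addnC trajD xp.
  have := rep_contract prm p rx rg; rewrite y3 -[(p * 3)%N]add0n traj_cycle /= => H.
  apply/eqP; rewrite -subr_eq0; apply/eqP/l1_eq0/eqP; rewrite eq_le l1_ge0 andbT.
  have L0 := l1_ge0 (traj x n - g).
  have : (1 / 2 : R) ^+ p <= 1 / 2.
    rewrite -[leRHS]expr1; apply: ler_wiXn2l => //; lra.
  move=> /(ler_wpM2l L0); lra.
apply/seteqP; split => [_ [m _ <-]|_ [m _ <-]].
  (* Adding [n * p], a multiple of the period, makes the index at least [n], so the subtraction is
     not truncated. *)
  exists (m + n * p - n)%N => //; rewrite -yg -trajD subnK;
    last by rewrite (leq_trans (leq_pmulr _ p0)) // leq_addl.
  by rewrite trajD periodic.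
by exists (m + n)%N => //; rewrite trajD yg.
Qed.

Hypothesis hg : 0 < h g.

(** The orbit has only three points, and [hg] keeps even the point playing A off the boundary
    [h = 0]. *)
Lemma cycle_margin : exists2 eta, 0 < eta & forall j, eta <= `|h (traj g j)|.
Proof.
have [[_ _ h1 h2 _] _] := rep_step prm rg.
exists (Num.min (h g) (Num.min (- h (g *m A)) (- h (g *m A *m B)))).
  by rewrite !lt_min hg !oppr_gt0 h1.
have hg0 := ltW hg; move=> j; rewrite (divn_eq j 3) addnC traj_cycle.
case: (j %% 3)%N (ltn_mod j 3) => [|[|[|//]]] _; rewrite !ge_min.
- by rewrite /= ler_norm.
- by rewrite traj1 FA // -(normrN (h (g *m A))) ler_norm !orbT.
- by rewrite trajS FA // traj1 FB // -(normrN (h (g *m A *m B))) ler_norm !orbT.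
Qed.

(** By induction: while the games agree the l1 distance does not grow, so it stays below the margin
    and the next game agrees too. *)
Lemma cycle_shadow eta x j : (forall j, eta <= `|h (traj g j)|) -> l1 (x - traj g j) < eta ->
  forall n, game_at rho (traj x n) = game_at rho (traj g (n + j)).
Proof.
move=> He xj; elim/ltn_ind => n IH.
have L : l1 (traj x n - traj (traj g j) n) < eta.
  apply: le_lt_trans xj; apply: l1_traj_same => // m mn; rewrite -trajD; exact: IH.
rewrite trajD; have := He (n + j)%N; rewrite trajD.
move: (traj x n) (traj (traj g j) n) L => a b L.
have := le_lt_trans (coord_le_l1 (a - b) 0) L.
rewrite mxE [(- b) 0 0]mxE -[a 0 0 - b 0 0](_ : h a - h b = _); last by rewrite /excess; ring.
rewrite ltr_norml => /andP[H1 H2] Hb.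
case: (game_atP rho b) => -[-> hb].
  by apply: game_atA; move: Hb; rewrite ger0_norm //; lra.
by apply: game_atB; move: Hb; rewrite ltr0_norm //; lra.
Qed.

Lemma cycle_asymptotically_stable : asymptotically_stable rho phi G.
Proof.
have [eta eta0 He] := cycle_margin.
have small x e : near_set G (e / 3) x -> exists j, l1 (x - traj g j) < e.
  move=> [_ [j _ <-] xj]; exists j; apply: le_lt_trans (l1_le_norm _) _.
  by move: xj; rewrite ltr_pdivlMr // mulrC.
split.
  move=> e e0; exists (Num.min eta e / 3); first by rewrite divr_gt0 // lt_min eta0.
  move=> x sx /small[j]; rewrite lt_min => /andP[xj xe] n.
  exists (traj g (n + j)); first by exists (n + j)%N.
  apply: le_lt_trans (norm_le_l1 _) _; apply: le_lt_trans xe; rewrite trajD.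
  by apply: l1_traj_same => // m mn; rewrite -trajD; exact: (cycle_shadow He).
exists (eta / 3); first by rewrite divr_gt0.
(* [j * 2] further steps bring the phase [j] to [j * 3], the start of a period. *)
move=> x sx /small[j xj]; apply: (@approaches_shift _ _ _ _ (j * 2));
  apply: approaches_rep => //.
split; first exact: simplex_traj.
move=> n; rewrite -trajD (cycle_shadow He xj) -addnA -mulnSr.
by rewrite traj_cycle; case: rg.
Qed.

End Cycle.

(** * Dynamics in the regions *)

Section Final.
Variables (R : realType) (rho phi : R).
Implicit Types x y v g : 'rV[R]_3.
Local Notation A := (PA phi).
Local Notation B := (PB rho phi).
Local Notation k := (kap phi).
Local Notation C := (drift rho phi).
Local Notation d := (detB rho phi).
Local Notation h := (excess rho).
Local Notation traj := (traj rho phi).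
Local Notation rep := (Delta_rep rho phi [::] [:: gA; gB; gB]).
Local Notation repB := (Delta_rep rho phi [::] [:: gB]).
Local Notation pi := (piB rho).
Local Notation E1 := (e1 rho phi).
Local Notation E2 := (e2 rho phi).
Local Notation apex := (apex rho phi).
Local Notation s := (sroot rho).
Hypothesis prm : [/\ 0 < rho, rho < 1, 2 / 3 < phi & phi <= 1].

Lemma DeltaAP x : DeltaA rho x <-> simplex x /\ 0 <= h x.
Proof. by rewrite /DeltaA /excess subr_ge0. Qed.

Lemma DeltaBP x : DeltaB rho x <-> simplex x /\ h x < 0.
Proof.
split=> [[sx nA]|[sx hx]].
  by split => //; rewrite ltNge; apply/negP => hx; apply: nA; apply/DeltaAP.
by split => // /DeltaAP[_]; rewrite leNgt hx.
Qed.

Lemma excess_ABB_rec x : simplex x -> h (x *m A *m B *m B) =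
  - 2 * k * h (x *m A *m B) - d * h (x *m A).
Proof. by move=> [_ xs]; rewrite (excess_BB prm) // mass_mulPA. Qed.

Lemma DeltaA_rep : 0 <= apex -> DeltaA rho `<=` rep.
Proof.
move=> ap; have d0 : d < 0.
  by rewrite ltNge; apply/negP => /(apex_lt0 prm); rewrite ltNge ap.
apply: rep_intro => x /DeltaAP[sx hx].
have h1 := excess_lt_after_A prm sx hx.
have h3 : 0 <= h (x *m A *m B *m B) := le_trans ap (apex_le prm sx).
have sx3 : simplex (x *m A *m B *m B).
  do 2 (apply: simplex_stochastic; first exact: (PB_stochastic prm)).
  by apply: simplex_stochastic => //; exact: (PA_stochastic prm).
split => //; last exact/DeltaAP.
have k0 := kap_gt0 prm; rewrite excess_ABB_rec // in h3.
rewrite -(pmulr_rlt0 _ k0).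
have : 0 < d * h (x *m A) by rewrite nmulr_rgt0.
lra.
Qed.

(** * The case of nonnegative [detB]: regions 9, 10 and 11 *)

Section GlobalCase.
Hypothesis d0 : 0 <= d.
Hypothesis ap : 0 < C + k * apex.

Lemma ABB_excess_ge0 x : simplex x -> h (x *m A) < 0 -> h (x *m A *m B) < 0 ->
  0 <= h (x *m A *m B *m B).
Proof.
move=> sx h1 h2; rewrite excess_ABB_rec //.
have : 0 <= k * - h (x *m A *m B) by rewrite mulr_ge0 ?oppr_ge0 // ltW // (kap_gt0 prm).
have : 0 <= d * - h (x *m A) by rewrite mulr_ge0 ?oppr_ge0 // ltW.
lra.
Qed.

Lemma ABB_rep x : DeltaA rho x -> h (x *m A *m B) < 0 -> rep x.
Proof.
move=> xA xB; apply: (rep_intro (P := [set x | DeltaA rho x /\ h (x *m A *m B) < 0])) => //.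
move=> {xA xB}x [/DeltaAP[sx hx] h2].
have h1 := excess_lt_after_A prm sx hx.
have h3 := ABB_excess_ge0 sx h1 h2.
have sx3 : simplex (x *m A *m B *m B).
  do 2 (apply: simplex_stochastic; first exact: (PB_stochastic prm)).
  by apply: simplex_stochastic => //; exact: (PA_stochastic prm).
split => //; split; first exact/DeltaAP.
by apply: (ABBAB_lt0 prm) => //; move: hx; rewrite /excess subr_ge0.
Qed.

Lemma AB_rep x : DeltaA rho x -> 0 <= h (x *m A *m B) ->
  rep (traj x 2) /\ traj x 2 = x *m A *m B.
Proof.
move=> /DeltaAP[sx hx] h2; have h1 := excess_lt_after_A prm sx hx.
have e2 : traj x 2 = x *m A *m B by rewrite trajS FA // traj1 FB.
split => //; apply: ABB_rep; first by apply/DeltaAP; split; [exact: simplex_traj|rewrite e2].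
by rewrite e2; apply: (ABAB_lt0 prm).
Qed.

(** When [h] is negative at two consecutive states joined by B, [excess_BB] makes it nonnegative
    after the next B. *)
Lemma DeltaB_enters x : DeltaB rho x -> exists n, DeltaA rho (traj x n).
Proof.
move=> /DeltaBP[sx hx].
have [h1|h1] := lerP 0 (h (traj x 1)).
  by exists 1%N; apply/DeltaAP; split => //; exact: simplex_traj.
exists 2%N; apply/DeltaAP; split; first exact: simplex_traj.
rewrite traj1 FB // in h1; rewrite trajS FB // traj1 FB //.
rewrite (excess_BB prm); last by case: sx.
have : 0 <= k * - h (x *m B) by rewrite mulr_ge0 ?oppr_ge0 // ltW // (kap_gt0 prm).
have : 0 <= d * - h x by rewrite mulr_ge0 ?oppr_ge0 // ltW.
lra.
Qed.

Lemma eventually_rep x : simplex x -> exists n, rep (traj x n).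
Proof.
move=> sx; have [n xA] : exists n, DeltaA rho (traj x n).
  have [hx|hx] := lerP 0 (h x); first by exists 0%N; apply/DeltaAP.
  by apply: DeltaB_enters; apply/DeltaBP.
have [h2|h2] := lerP 0 (h (traj x n *m A *m B)).
  by exists (2 + n)%N; rewrite trajD; case: (AB_rep xA h2).
by exists n; exact: ABB_rep.
Qed.

Lemma word_ABBA : Delta_word rho phi [:: gA; gB; gB; gA] = rep.
Proof.
apply/seteqP; split => x; last first.
  by move=> [sx Hx]; split => // -[|[|[|[|//]]]] _; rewrite Hx.
move=> [sx Hx].
have h0 : 0 <= h x by apply: game_at_A; exact: (Hx 0%N).
have xA : DeltaA rho x by apply/DeltaAP.
have h1 := excess_lt_after_A prm sx h0.
apply: ABB_rep => //; apply: game_at_B.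
by have := Hx 2%N isT; rewrite trajS FA // traj1 FB.
Qed.

Lemma word_AB : DeltaA rho `\` Delta_word rho phi [:: gA; gB; gB; gA]
  = Delta_rep rho phi [:: gA; gB] [:: gA; gB; gB].
Proof.
rewrite word_ABBA; apply/seteqP; split => x.
  move=> [xA nr]; have /DeltaAP[sx h0] := xA.
  have h2 : 0 <= h (x *m A *m B).
    by rewrite leNgt; apply/negP => h2; apply: nr; exact: ABB_rep.
  have [[_ r2] e2] := AB_rep xA h2.
  have h1 := excess_lt_after_A prm sx h0.
  split => // -[|[|n]]; first by rewrite /= game_atA.
    by rewrite traj1 FA // game_atB.
  by rewrite -addn2 trajD r2 /= subn0 addn2 subSS subn1.
move=> [sx Hx].
have h0 : 0 <= h x by apply: game_at_A; exact: (Hx 0%N).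
split; first exact/DeltaAP.
(* The two game sequences first differ at index 2. *)
by move=> [_ r]; have := Hx 2%N; rewrite (r 2%N).
Qed.
End GlobalCase.

(** * Trajectories that play B forever, when [detB] is negative *)

Section PlayingB.
Hypothesis d0 : d < 0.

Lemma piB_simplex : simplex pi.
Proof.
split; last by rewrite mass_row3 (pi_sum prm).
by apply: ord3P; rewrite row3E ltW // ?(pi0_gt0 prm) ?(pi1_gt0 prm) ?(pi2_gt0 prm).
Qed.

Lemma sub_pi x : (pi - x) 0 0 = - h x.
Proof. by rewrite mxE [(- x) 0 0]mxE row3E /excess opprB. Qed.

Lemma e1_gt0 : 0 < E1.
Proof. by rewrite -(nmulr_rlt0 _ (e2_lt0 prm)) mulrC (e1_mul_e2 prm). Qed.

Lemma e1_lt1 : E1 < 1.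
Proof.
by have := e1_add_e2 prm; have := e2_lt0 prm; have := ler_norm E1; lra.
Qed.

Lemma eform_excess x : 2 * s * h x = eform s (x - pi) - eform (- s) (x - pi).
Proof. by rewrite /eform ![(x - pi) 0 _]mxE ![(- pi) 0 _]mxE !row3E /excess; ring. Qed.

Lemma eform_traj t e x n : t ^+ 2 * (1 + rho ^+ 2) = 1 + 4 * rho + rho ^+ 2 ->
  e = - k - phi * (1 - rho) * t / (2 * (1 + rho)) -> simplex x ->
  (forall m, (m < n)%N -> h (traj x m) < 0) ->
  eform t (traj x n - pi) = e ^+ n * eform t (x - pi).
Proof.
move=> tt et sx; elim: n => [|n IH] H; first by rewrite expr0 mul1r.
rewrite /Defs.traj iterS -/(traj x n) FB ?H // -[in LHS](piB_fix prm) -mulmxBl.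
rewrite (eform_B prm _ tt et); last exact: (simplex_diff (simplex_traj prm n sx) piB_simplex).
by rewrite IH ?exprS ?mulrA // => m mn; exact/H/ltnW.
Qed.

Lemma repB_excess x n : repB x -> h (traj x n) < 0.
Proof. by move=> [_ H]; apply: game_at_B; rewrite H /= modn1. Qed.

(** The component of [x - pi] along the eigenvalue [E2], which is negative and of larger modulus
    than [E1], would eventually dominate and make [h] change sign at every step. *)
Lemma repB_eform x : repB x -> eform s (x - pi) = 0.
Proof.
move=> rx; have [sx _] := rx; apply/eqP/negPn/negP => q0.
set q := eform s (x - pi) in q0; set p := eform (- s) (x - pi).
have s0 := sroot_gt0 prm.
have et2 : E2 = - k - phi * (1 - rho) * s / (2 * (1 + rho)).
  by rewrite e2E // /gap; field; exact: (den1 prm).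
have et1 : E1 = - k - phi * (1 - rho) * (- s) / (2 * (1 + rho)).
  by rewrite e1E // /gap; field; exact: (den1 prm).
have lt n : q * E2 ^+ n < p * E1 ^+ n.
  have := repB_excess n rx; rewrite -(pmulr_rlt0 _ (mulr_gt0 (ltr0Sn R 1) s0)) eform_excess.
  rewrite (eform_traj (sroot_sqr prm) et2 sx) => [|m _]; last exact: repB_excess.
  rewrite (eform_traj _ et1 sx) ?sqrrN ?(sroot_sqr prm) // => [|m _]; last exact: repB_excess.
  by rewrite subr_lt0 [_ * eform s _]mulrC [_ * eform (- s) _]mulrC.
have b0 : 0 < - E2 by rewrite oppr_gt0; exact: e2_lt0.
have ab := e1_lt_e2 prm.
have r0 : 0 <= `|E1| / - E2 by rewrite divr_ge0 // ltW.
have r1 : `|E1| / - E2 < 1 by rewrite ltr_pdivrMr // mul1r.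
have q1 : 0 < `|q| by rewrite normr_gt0.
have [N HN] := geometric_small `|p| r0 r1 q1.
have big n : (N <= n)%N -> p * E1 ^+ n < `|q| * (- E2) ^+ n.
  move=> /HN; rewrite expr_div_n mulrA ltr_pdivrMr ?exprn_gt0 //; apply: le_lt_trans.
  by apply: le_trans (ler_norm _) _; rewrite normrM normrX.
(* The parity of the exponent is chosen so that [q * E2 ^+ n] equals [|q| * (- E2) ^+ n]. *)
have [qp|qn] := ltrP 0 q.
  have := lt_trans (lt (N * 2)%N) (big (N * 2)%N (leq_pmulr N (isT : (0 < 2)%N))).
  by rewrite (gtr0_norm qp) ltr_pM2l // mulnC !exprM sqrrN ltxx.
have qn' : q < 0 by rewrite lt_neqAle q0.
have NN : (N <= (N * 2).+1)%N := leqW (leq_pmulr N (isT : (0 < 2)%N)).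
have := lt_trans (lt _) (big _ NN).
by rewrite (ltr0_norm qn') ![_ ^+ (N * 2).+1]exprS mulnC !exprM sqrrN !mulNr !mulrN opprK ltxx.
Qed.

(** Zero-sum vectors form a plane, where the kernel of the eigenform for [E2] is the eigenline for
    [E1]. *)
Lemma eigenvector_pi x : simplex x -> eform s (x - pi) = 0 -> (x - pi) *m B = E1 *: (x - pi).
Proof.
move=> sx q0.
have s0 := sroot_gt0 prm.
have et2 : E2 = - k - phi * (1 - rho) * s / (2 * (1 + rho)).
  by rewrite e2E // /gap; field; exact: (den1 prm).
have et1 : E1 = - k - phi * (1 - rho) * (- s) / (2 * (1 + rho)).
  by rewrite e1E // /gap; field; exact: (den1 prm).
have m0 := simplex_diff sx piB_simplex.
have h2 := eform_B prm m0 (sroot_sqr prm) et2.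
have t2 : (- s) ^+ 2 * (1 + rho ^+ 2) = 1 + 4 * rho + rho ^+ 2 by rewrite sqrrN (sroot_sqr prm).
have h1 := eform_B prm m0 t2 et1.
have mB : \sum_i ((x - pi) *m B) 0 i = 0 by rewrite mass_mulPB.
move: h1 h2 m0 mB q0; move: ((x - pi) *m B) => w; move: (x - pi : 'rV[R]_3) => v.
rewrite !sum_ord3 /eform => h1 h2 m0 mB q0; rewrite q0 mulr0 in h2.
have w0 : w 0 0 = E1 * v 0 0.
  have : 2 * s * (w 0 0 - E1 * v 0 0) = 0.
    have : E1 * ((1 + s) * v 0 0 + 2 * v 0 1) = 0 by rewrite q0 mulr0.
    lra.
  have s2 : 2 * s != 0 by apply: lt0r_neq0; apply: mulr_gt0.
  by move/eqP; rewrite mulf_eq0 (negbTE s2) /= subr_eq0 => /eqP.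
have w1 : w 0 1 = E1 * v 0 1.
  have : E1 * ((1 + s) * v 0 0 + 2 * v 0 1) = 0 by rewrite q0 mulr0.
  by rewrite w0 in h2; lra.
apply/rowP; apply: ord3P; rewrite mxE //.
have : E1 * (v 0 0 + v 0 1 + v 0 2) = 0 by rewrite m0 mulr0.
by rewrite w0 w1 in mB; lra.
Qed.

Lemma traj_eigen x n : DeltaB rho x -> eform s (x - pi) = 0 ->
  traj x n = pi + E1 ^+ n *: (x - pi).
Proof.
move=> /DeltaBP[sx hx] q0; have ev := eigenvector_pi sx q0.
elim: n => [|n IH]; first by rewrite expr0 scale1r addrC subrK.
have hn : h (traj x n) < 0.
  have -> : h (traj x n) = E1 ^+ n * h x.
    by rewrite IH /excess !mxE /=; ring.
  by rewrite pmulr_rlt0 // exprn_gt0 // e1_gt0.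
rewrite /Defs.traj iterS -/(traj x n) FB // IH mulmxDl (piB_fix prm) -scalemxAl ev.
by rewrite scalerA exprSr.
Qed.

Lemma repB_E : repB = [set x | DeltaB rho x /\ eform s (x - pi) = 0].
Proof.
apply/seteqP; split => x.
  move=> rx; split; last exact: repB_eform.
  by apply/DeltaBP; split; [case: rx|exact: (repB_excess 0)].
move=> [xB q0]; have /DeltaBP[sx hx] := xB; split => // n.
rewrite /= modn1 /=; apply: game_atB; rewrite (traj_eigen n xB q0).
have -> : h (pi + E1 ^+ n *: (x - pi)) = E1 ^+ n * h x by rewrite /excess !mxE /=; ring.
by rewrite pmulr_rlt0 // exprn_gt0 // e1_gt0.
Qed.

Lemma repB_cvg x : repB x -> traj x n @[n --> \oo] --> pi.
Proof.
rewrite repB_E => -[xB q0].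
rewrite (_ : (fun n => traj x n) = (fun n => pi + E1 ^+ n *: (x - pi))); last first.
  by apply/funext => n; exact: traj_eigen.
rewrite -[X in _ --> X]addr0 -(scale0r (x - pi)).
apply: cvgD; first exact: cvg_cst.
apply: cvgZr_tmp; apply: cvg_expr.
by rewrite gtr0_norm ?e1_gt0 // e1_lt1.
Qed.

Lemma repB_nonempty : repB !=set0.
Proof.
have s0 := sroot_gt0 prm; have s2 := sroot_lt2 prm.
have a0 := pi0_gt0 prm; have a1 := pi1_gt0 prm; have a2 := pi2_gt0 prm; have as_ := pi_sum prm.
have a02 : pi0 rho <= 2 * pi2 rho.
  rewrite /pi0 /pi2 mulrA ler_pM2r ?invr_gt0 ?mulr_gt0 ?(den3_gt0 prm) //.
  by case: (prm) => r0 r1 f0 f1; nra.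
(* The line [eform s (x - pi) = 0] meets the side [x_0 = 0] at this point; [a02] and [s < 2] give
   [X <= 1]. *)
pose X := pi1 rho + pi0 rho * (1 + s) / 2.
exists (row3 0 X (1 - X)); rewrite repB_E.
have p1 : 0 <= pi0 rho * s by rewrite mulr_ge0 // ltW.
have p2 : 0 <= pi0 rho * (2 - s) by rewrite mulr_ge0 // ltW //; lra.
split.
  apply/DeltaBP; split; last by rewrite /excess row3E sub0r oppr_lt0.
  split; last by rewrite mass_row3; ring.
  by apply: ord3P; rewrite row3E // /X; lra.
by rewrite /eform ![(_ - pi) 0 _]mxE ![(- pi) 0 _]mxE !row3E /X; field.
Qed.
End PlayingB.

Lemma piB_unstable : 0 <= apex -> unstable_equilibrium rho phi pi.
Proof.
move=> ap; have d0 : d < 0.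
  by rewrite ltNge; apply/negP => /(apex_lt0 prm); rewrite ltNge ap.
split; [exact: piB_simplex|exact: (piB_fix prm)|exact: repB_nonempty|exact: repB_cvg|].
move=> e e0; have a0 := pi0_gt0 prm; have a1 := pi1_gt0 prm; have a2 := pi2_gt0 prm;
  have as_ := pi_sum prm.
have C0 := drift_gt0 prm; have k0 := kap_gt0 prm.
(* The witness is [pi + t * (1, -1, 0)]: [t <= pi1] keeps it in the simplex, and its l1 distance
   [2 * t] to [pi] is below [e]. *)
pose t := Num.min (pi1 rho) (e / 4).
have t0 : 0 < t by rewrite lt_min a1 divr_gt0.
have t1 : t <= pi1 rho by rewrite ge_min lexx.
have t2 : t <= e / 4 by rewrite ge_min lexx orbT.
pose x := row3 (pi0 rho + t) (pi1 rho - t) (pi2 rho).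
have sx : simplex x.
  split; last by rewrite mass_row3; lra.
  by apply: ord3P; rewrite row3E; lra.
have xp i : (x - pi) 0 i = (row3 t (- t) 0) 0 i.
  by rewrite mxE [(- pi) 0 i]mxE; move: i; apply: ord3P; rewrite !row3E; ring.
have rx : rep x.
  by apply: DeltaA_rep => //; apply/DeltaAP; split => //; rewrite /excess row3E; lra.
exists x; split => //.
- apply/eqP => /rowP/(_ 0); rewrite !row3E; lra.
- apply: le_lt_trans (norm_le_l1 _) _.
  by rewrite /l1 sum_ord3 !xp !row3E normrN normr0 gtr0_norm //; lra.
(* Each A leaves [h <= - C], so at the times [1 + N * 3] the trajectory is at distance at least [C]
   from [pi]. *)
move=> /cvgrPdist_lt/(_ _ C0)[N _ HN].
have NN : (N <= 1 + N * 3)%N := leq_trans (leq_pmulr N (isT : (0 < 3)%N)) (leq_addl _ _).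
have ry : rep (traj x (N * 3)).
  split; first exact: simplex_traj.
  by move=> n; rewrite -trajD; case: rx => _ ->; rewrite /= !subn0 addnC modnMDl.
have [[sy hy h1 _ _] _] := rep_step prm ry.
have H : `|pi - traj x (1 + N * 3)| < C := HN _ NN.
rewrite trajD traj1 FA // in H.
have := le_lt_trans (coord_le_norm _ 0) H.
rewrite sub_pi normrN ltr_norml => /andP[+ _].
rewrite (excess_A prm sy.2); have := mulr_ge0 (ltW k0) hy; lra.
Qed.

End Final.

Unset Implicit Arguments.

Theorem theorem8 (R : realType) (rho phi : R) :
  (region3 rho phi ->
    [/\ exists G : set 'rV[R]_3,
          [/\ limit_cycle rho phi G,
              (forall G', limit_cycle rho phi G' -> G' = G),
              asymptotically_stable rho phi G
            & form12 rho phi G],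
        unstable_equilibrium rho phi (piB rho),
        DeltaA rho = Delta_rep rho phi [::] [:: gA; gB; gB],
        (forall x, (DeltaB rho `\` Delta_rep rho phi [::] [:: gB]) x ->
           exists n, DeltaA rho (traj rho phi x n))
      & Delta_rep rho phi [::] [:: gB] =
        [set x | DeltaB rho x /\
           (1 + Sroot rho / (1 + rho ^+ 2)) * (x 0 0 - pi0 rho)
           + 2 * (x 0 1 - pi1 rho) = 0]])
  /\
  (region9 rho phi \/ region10 rho phi \/ region11 rho phi ->
    [/\ exists G : set 'rV[R]_3,
          [/\ limit_cycle rho phi G,
              (forall G', limit_cycle rho phi G' -> G' = G),
              globally_asymptotically_stable rho phi G
            & form12 rho phi G],
        Delta_word rho phi [:: gA; gB; gB; gA]
          = Delta_rep rho phi [::] [:: gA; gB; gB],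
        DeltaA rho `\` Delta_word rho phi [:: gA; gB; gB; gA]
          = Delta_rep rho phi [:: gA; gB] [:: gA; gB; gB]
      & forall x, DeltaB rho x -> exists n, DeltaA rho (traj rho phi x n)]).
Proof.
split.
  move=> r3; have ap := region3_apex r3; have [base _] := r3.
  have prm := base_region_bounds base; have [_ _ G0] := base.
  have [g [sg gT]] := cycle_exists prm.
  have hg := excess_cycle_gt0 prm G0 sg.2 gT.
  have d0 : detB rho phi < 0.
    by rewrite ltNge; apply/negP => /(apex_lt0 prm); rewrite ltNge ap.
  have AE : DeltaA rho = Delta_rep rho phi [::] [:: gA; gB; gB].
    apply/seteqP; split; first exact: DeltaA_rep.
    by move=> x [sx Hx]; apply/DeltaAP; split => //; apply: game_at_A; exact: (Hx 0%N).
  have rg : Delta_rep rho phi [::] [:: gA; gB; gB] g.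
    by rewrite -AE; apply/DeltaAP; split => //; exact: ltW.
  have enter x : (DeltaB rho `\` Delta_rep rho phi [::] [:: gB]) x ->
           exists n, DeltaA rho (traj rho phi x n).
    move=> [/DeltaBP[sx hx] nB]; apply: contra_notP nB => nA; split => // n.
    rewrite /= modn1; apply: game_atB; rewrite ltNge; apply/negP => hn.
    by apply: nA; exists n; apply/DeltaAP; split => //; exact: simplex_traj.
  split => //.
  - exists (range (traj rho phi g)); split.
    + exact: (cycle_limit_cycle prm).
    + move=> G' [x [p [sx p0 xp ->]]].
      have [n rx] : exists n, DeltaA rho (traj rho phi x n).
        have [hx|hx] := lerP 0 (excess rho x); first by exists 0%N; apply/DeltaAP.
        apply: enter; split; first exact/DeltaBP.
        (* A periodic point playing B forever would have its negative excess multiplied by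
           [e1 ^+ p < 1] over a period. *)
        move=> rB; have := repB_cvg prm d0 rB.
        move: rB; rewrite (repB_E prm d0) => -[xB q0] _.
        have := traj_eigen prm d0 p xB q0; rewrite xp => e.
        have : excess rho x = e1 rho phi ^+ p * excess rho x.
          by rewrite {1}e /excess !mxE /=; ring.
        have : e1 rho phi ^+ p < 1.
          by rewrite exprn_ilt1 ?ltW ?(e1_gt0 prm d0) ?(e1_lt1 prm) // -lt0n.
        by move=> e1p; nra.
      by rewrite AE in rx; exact: (cycle_unique prm rg gT p0 xp rx).
    + exact: (cycle_asymptotically_stable prm).
    + exact: cycle_form12.
  - exact: piB_unstable.
  - by rewrite (repB_E prm d0); apply/seteqP; split => x;
    rewrite /= /eform ![(x - _) 0 _]mxE ![(- piB rho) 0 _]mxE !row3E.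
move=> reg; have [base d0 ap] := region_apex reg.
have prm := base_region_bounds base; have [_ _ G0] := base.
have [g [sg gT]] := cycle_exists prm.
have hg := excess_cycle_gt0 prm G0 sg.2 gT.
have gpi : pi0 rho <= g 0 0 by rewrite -subr_ge0 ltW.
have rg : Delta_rep rho phi [::] [:: gA; gB; gB] g.
  apply: (ABB_rep prm) => //.
  (* As ABB fixes [g], the state after ABBAB is the state after AB. *)
  by have := ABBAB_lt0 prm sg gpi d0 ap; rewrite gT.
split.
- exists (range (traj rho phi g)); split.
  + exact: (cycle_limit_cycle prm).
  + move=> G' [x [p [sx p0 xp ->]]].
    have [n rx] := eventually_rep prm d0 ap sx.
    exact: (cycle_unique prm rg gT p0 xp rx).
  + split; first exact: (cycle_asymptotically_stable prm rg gT hg).1.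
    move=> x /(eventually_rep prm d0 ap)[n rx].
    by apply: (@approaches_shift _ _ _ _ n); exact: (approaches_rep prm).
  + exact: cycle_form12.
- exact: (word_ABBA prm).
- exact: (word_AB prm).
- exact: (DeltaB_enters prm).
Qed.
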